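(* Let $\Sigma$ be a plane in the family $\{ (x,y,z)\in E(1,1): a x+b y+ c=0\}$, $a,b,c\in \mathbb{R}$. Then $\Sigma$ is stable.
   Context: $E(1,1)$ denotes $\mathbb{R}^3$ with coordinates $(x,y,z)$ and the left-invariant vector fields $X=\partial_z$, $Y=\frac{1}{\sqrt2}(-e^{z}\partial_x+e^{-z}\partial_y)$, $T=\frac{1}{\sqrt2}(e^{z}\partial_x+e^{-z}\partial_y)$, with the Riemannian metric $\langle\cdot,\cdot\rangle$ making $\{X,Y,T\}$ orthonormal. The horizontal distribution is $\mathcal{H}=\mathrm{span}\{X,Y\}$. For a surface $\Sigma$ with Riemannian unit normal $N$, $N_h$ is the orthogonal projection of $N$ onto $\mathcal{H}$. The sub-Riemannian area is $A(\Sigma)=\int_\Sigma|N_h|\,d\Sigma$, with $d\Sigma$ the Riemannian area element. An area-stationary surface (critical point of $A$ under compactly supported deformations) is stable if the second derivative of the area at $0$ is nonnegative for every compactly supported variation. *)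

(* Defs.v *)
From mathcomp Require Import all_boot all_order all_algebra.
From mathcomp Require Import ring lra.
From mathcomp Require Import all_classical all_reals all_analysis.

Set Implicit Arguments.
Unset Strict Implicit.
Unset Printing Implicit Defensive.

Import Order.TTheory GRing.Theory Num.Theory.
Import numFieldNormedType.Exports.

Local Open Scope classical_set_scope.
Local Open Scope ring_scope.

(* U is meant to be open: the derivatives below are not relative to U. *)
Fixpoint Ck_on {R : realType} {V W : normedModType R} (U : set V) (n : nat)
    (f : V -> W) : Prop :=
  match n with
  | 0%N => forall x, U x -> {for x, continuous f}
  | m.+1 => (forall x, U x -> differentiable f x) /\
            forall v, Ck_on U m ('D_v f)
  end.

(* E(1,1) is R * R * R with coordinates ((x, y), z); tangent vectors are given
   by their components in the basis d/dx, d/dy, d/dz. *)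
Section Geometry.
Context {R : realType}.
Implicit Types (p v w : R * R * R) (q : R * R).

Definition frameX p : R * R * R := (0, 0, 1).
Definition frameY p : R * R * R :=
  (- expR p.2 / Num.sqrt 2, expR (- p.2) / Num.sqrt 2, 0).
Definition frameT p : R * R * R :=
  (expR p.2 / Num.sqrt 2, expR (- p.2) / Num.sqrt 2, 0).

(* e^{-2z} dx^2 + e^{2z} dy^2 + dz^2, the metric for which X, Y, T are
   orthonormal: see [frame_orthonormal]. *)
Definition metric p v w : R :=
  expR (- p.2) ^+ 2 * (v.1.1 * w.1.1) + expR p.2 ^+ 2 * (v.1.2 * w.1.2)
  + v.2 * w.2.

Definition mnorm p v : R := Num.sqrt (metric p v v).

Lemma frame_orthonormal p :
  [/\ metric p (frameX p) (frameX p) = 1,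
      metric p (frameY p) (frameY p) = 1,
      metric p (frameT p) (frameT p) = 1,
      metric p (frameX p) (frameY p) = 0 &
      metric p (frameX p) (frameT p) = 0 /\
      metric p (frameY p) (frameT p) = 0].
Proof.
have s2 : Num.sqrt (2 : R) ^+ 2 = 2 by rewrite sqr_sqrtr.
have s0 : Num.sqrt (2 : R) != 0 by rewrite sqrtr_eq0 -ltNge.
have e0 : expR p.2 != 0 by rewrite gt_eqF ?expR_gt0.
have h : (Num.sqrt (2 : R))^-1 ^+ 2 = 2^-1 by rewrite exprVn s2.
have k : expR (- p.2) * expR p.2 = 1 by rewrite expRN mulVf.
rewrite /metric /frameX /frameY /frameT /=.
set s := (Num.sqrt 2)^-1 in h *; set e := expR p.2 in k *.
set e' := expR (- p.2) in k *.
have a : e' ^+ 2 * (e * s * (e * s)) = 2^-1.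
  by rewrite -h -[RHS]mul1r -(expr1n _ 2) -k; ring.
have b : e ^+ 2 * (e' * s * (e' * s)) = 2^-1.
  by rewrite -h -[RHS]mul1r -(expr1n _ 2) -k; ring.
by split; [lra | lra | lra | lra | split; lra].
Qed.

(* Orthogonal projection onto the horizontal distribution span {X, Y}. *)
Definition hproj p v : R * R * R :=
  metric p v (frameX p) *: frameX p + metric p v (frameY p) *: frameY p.

(* Riemannian cross product: the Euclidean one with its index raised (the
   Riemannian volume form is dx dy dz). *)
Definition cross p v w : R * R * R :=
  (expR p.2 ^+ 2 * (v.1.2 * w.2 - v.2 * w.1.2),
   expR (- p.2) ^+ 2 * (v.2 * w.1.1 - v.1.1 * w.2),
   v.1.1 * w.1.2 - v.1.2 * w.1.1).

Lemma cross_orthogonal p v w :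
  metric p (cross p v w) v = 0 /\ metric p (cross p v w) w = 0.
Proof.
have k : expR (- p.2) * expR p.2 = 1.
  by rewrite expRN mulVf // gt_eqF ?expR_gt0.
rewrite /metric /cross /=.
set e := expR p.2 in k *; set e' := expR (- p.2) in k *.
have k2 a b c d f g : e' ^+ 2 * (e ^+ 2 * a * b) + e ^+ 2 * (e' ^+ 2 * c * d)
    + f * g = a * b + c * d + f * g.
  transitivity ((e' * e) ^+ 2 * (a * b + c * d) + f * g); first by ring.
  by rewrite k expr1n mul1r.
by split; rewrite k2; ring.
Qed.

Section ParametrizedSurface.
Variable S : R * R -> R * R * R.

Definition tangent1 q : R * R * R := 'D_((1, 0) : R * R) S q.
Definition tangent2 q : R * R * R := 'D_((0, 1) : R * R) S q.

Definition immersion := forall q, differentiable S q /\ injective ('d S q).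

Definition unit_normal q : R * R * R :=
  let n := cross (S q) (tangent1 q) (tangent2 q) in (mnorm (S q) n)^-1 *: n.

(* Gram determinant: d Sigma = area_element du dv. *)
Definition area_element q : R :=
  Num.sqrt (metric (S q) (tangent1 q) (tangent1 q)
            * metric (S q) (tangent2 q) (tangent2 q)
            - metric (S q) (tangent1 q) (tangent2 q) ^+ 2).

Definition sR_area (C : set (R * R)) : R :=
  \int[(lebesgue_measure \x lebesgue_measure)%E]_(q in C)
    (mnorm (S q) (hproj (S q) (unit_normal q)) * area_element q).

End ParametrizedSurface.

(* S is a global C^2 parametrization of the embedded surface Sigma. *)
Definition parametrizes (S : R * R -> R * R * R) (Sigma : set (R * R * R)) :=
  [/\ Ck_on setT 2 S, immersion S, range S = Sigma &
      exists g : R * R * R -> R * R,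
        {within Sigma, continuous g} /\ cancel S g].

(* A variation F t, |t| < e, of the surface parametrized by S, supported in the
   compact set C of parameters. *)
Definition surface_variation (S : R * R -> R * R * R) (e : R) (C : set (R * R))
    (F : R -> R * R -> R * R * R) :=
  [/\ 0 < e /\ compact C,
      Ck_on (`]- e, e[ `*` setT) 2 (fun x : R * (R * R) => F x.1 x.2),
      F 0 = S,
      forall t, `|t| < e -> immersion (F t) &
      forall t q, `|t| < e -> ~ C q -> F t q = S q].

(* The part of the surface outside the support is fixed, so only the (finite)
   area of the part in the support matters. *)
Definition varied_area (C : set (R * R)) (F : R -> R * R -> R * R * R)
  (t : R) : R := sR_area (F t) C.

Definition area_stationary (Sigma : set (R * R * R)) :=
  (exists S, parametrizes S Sigma) /\
  forall S e C F, parametrizes S Sigma -> surface_variation S e C F ->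
    is_derive (0 : R) (1 : R) (varied_area C F) 0.

(* The second derivative at 0, possibly infinite: a variation that moves the
   singular set (the points where N_h = 0) may have second derivative +oo. *)
Definition has_second_derivative (A : R -> R) (l : \bar R) :=
  (\forall t \near (0 : R), derivable A t 1) /\
  ((derive1 A t - derive1 A 0) / t)%:E @[t --> (0 : R)^'] --> l.

Definition lower_second_derivative (A : R -> R) : \bar R :=
  limf_einf (fun t : R => (2 * (A t - A 0 - derive1 A 0 * t) / t ^+ 2)%:E)
    (0 : R)^'.

(* By Taylor's formula the two clauses agree when A has a second derivative at
   0; the second one only matters for variations along which A has none. *)
Definition second_derivative_ge0 (A : R -> R) :=
  (forall l, has_second_derivative A l -> (0 <= l)%E) /\
  (0 <= lower_second_derivative A)%E.

Definition stable (Sigma : set (R * R * R)) :=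
  area_stationary Sigma /\
  forall S e C F, parametrizes S Sigma -> surface_variation S e C F ->
    second_derivative_ge0 (varied_area C F).

Definition vplane (a b c : R) : set (R * R * R) :=
  [set p | a * p.1.1 + b * p.1.2 + c = 0].

End Geometry.

(* Main.v *)
Require Import Defs.
From mathcomp Require Import all_boot all_order all_algebra.
From mathcomp Require Import ring lra.
From mathcomp Require Import all_classical all_reals all_analysis.
From mathcomp Require Import measurable_realfun.

(** On a parametrized surface, |N_h| dSigma is the Euclidean length of the pair of
    fluxes of X and Y through the parallelogram of the two coordinate tangent
    vectors ([sR_density]). The field Y is divergence-free and tangent to the level
    sets of z, so k(z) Y is divergence-free for every function k: its flux form is
    exact, and its flux does not change when the surface is modified inside a compact
    set ([calib_invariant]). If |k| <= 1, this flux is a lower bound for the area.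

    On the plane a x + b y + c = 0 the horizontal normal N_h is a multiple of Y, and
    the factor is a e^z - b e^{-z} ([conormalY]) up to a nonvanishing function of z.
    Taking for k the sign of this factor yields a calibration of the whole plane,
    although N_h vanishes and k jumps on the line where the factor is zero: the jump
    of k(z) Y occurs across a level set of z, to which Y is tangent. Replacing the
    sign by a smooth approximation and passing to the limit shows that the plane has
    the least area among all its compactly supported deformations
    ([vplane_minimizing]).

    Hence the area A(t) along a variation has a minimum at 0. The remaining point is
    that A is differentiable at 0, which is not automatic, for the density has
    corners where N_h = 0. As A(t) - A(0) is between 0 and A(t) + A(-t) - 2 A(0), it
    is enough that the symmetric difference of A is o(t). The densities are Lipschitz
    in t, and differentiable at t = 0 off the singular set, which is null
    ([null_singular_set]), so this follows by dominated convergence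
    ([symmetric_quotient_area]). Therefore A'(0) = 0, and both conditions on the
    second derivative at 0 follow from minimality ([second_derivative_ge0_of_min]).
    *)

Set Implicit Arguments.
Unset Strict Implicit.
Unset Printing Implicit Defensive.

Import Order.TTheory GRing.Theory Num.Theory.
Import numFieldNormedType.Exports.

Local Open Scope classical_set_scope.
Local Open Scope ring_scope.

(** * Functions of class C1 and C2 *)

Section C1.
Context {R : realType}.
Implicit Types V W : normedModType R.

(** Continuity at a point of the open set U is local, so that a formula for the
    derivative on U suffices. *)
Lemma C1_intro V W (U : set V) (f : V -> W) (Df : V -> V -> W) : open U ->
  (forall x, U x -> differentiable f x) ->
  (forall v x, U x -> 'D_v f x = Df v x) ->
  (forall v x, U x -> {for x, continuous (Df v)}) ->
  Ck_on U 1 f.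
Proof.
move=> oU df eDf cDf; split=> // v x Ux.
have := cDf v x Ux; rewrite /prop_for /continuous_at -eDf //.
apply: cvg_trans; apply: near_eq_cvg.
by apply: filterS (open_nbhs_nbhs (conj oU Ux)) => y Uy; rewrite /= eDf.
Qed.

Lemma C1_continuous V W (U : set V) (f : V -> W) :
  Ck_on U 1 f -> forall x, U x -> {for x, continuous f}.
Proof. by move=> [df _] x /df; exact: differentiable_continuous. Qed.

Lemma derive_linear V W W' (L : {linear W -> W'}) (f : V -> W) (v x : V) :
  continuous L -> differentiable f x -> 'D_v (L \o f) x = L ('D_v f x).
Proof.
move=> cL df; rewrite !deriveE //.
  by rewrite diff_comp // ?diff_lin //; exact: linear_differentiable.
by apply: differentiable_comp => //; exact: linear_differentiable.
Qed.

Lemma C1_linear V W W' (L : {linear W -> W'}) (U : set V) (f : V -> W) :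
  open U -> continuous L -> Ck_on U 1 f -> Ck_on U 1 (L \o f).
Proof.
move=> oU cL [df cDf]; apply: (@C1_intro V W' U _ (fun v x => L ('D_v f x)) oU).
- by move=> x Ux; apply: differentiable_comp; [exact: df|
    exact: linear_differentiable].
- by move=> v x Ux; rewrite derive_linear //; exact: df.
- by move=> v x Ux; apply: continuous_comp; [exact: cDf|exact: cL].
Qed.

Lemma C2_linear V W W' (L : {linear W -> W'}) (f : V -> W) :
  continuous L -> Ck_on setT 2 f -> Ck_on setT 2 (L \o f).
Proof.
move=> cL [df cDf]; split.
  by move=> x Ux; apply: differentiable_comp; [exact: df|
    exact: linear_differentiable].
move=> v; rewrite (_ : 'D_v (L \o f) = L \o 'D_v f).
  by apply: C1_linear => //; exact: openT.
by apply/funext => x; rewrite derive_linear //; exact: df.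
Qed.

Lemma C1_cst V W (U : set V) (w : W) : open U -> Ck_on U 1 (cst w : V -> W).
Proof.
move=> oU; apply: (@C1_intro V W U _ (fun v x => 0) oU).
- by move=> x _; exact: differentiable_cst.
- by move=> v x _; rewrite derive_cst.
- by move=> v x _; exact: cst_continuous.
Qed.

Lemma C1_id V (U : set V) : open U -> Ck_on U 1 (fun r : V => r).
Proof.
move=> oU; apply: (@C1_intro V V U _ (fun v x => v) oU) => //.
- by move=> v x _; exact: derive_id.
- by move=> v x _; exact: cst_continuous.
Qed.

Lemma C1D V W (U : set V) (f g : V -> W) : open U ->
  Ck_on U 1 f -> Ck_on U 1 g -> Ck_on U 1 (fun x => f x + g x).
Proof.
move=> oU [df cf] [dg cg].
apply: (@C1_intro V W U _ (fun v x => 'D_v f x + 'D_v g x) oU).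
- by move=> x Ux; apply: differentiableD; [exact: df|exact: dg].
- move=> v x Ux; apply: (@deriveD _ _ _ f g); apply: diff_derivable.
    exact: df.
  exact: dg.
- move=> v x Ux; apply: (@continuousD _ _ _ ('D_v f) ('D_v g)).
    exact: cf.
  exact: cg.
Qed.

Lemma C1M V (U : set V) (f g : V -> R) : open U ->
  Ck_on U 1 f -> Ck_on U 1 g -> Ck_on U 1 (fun x => f x * g x).
Proof.
move=> oU Cf Cg; have [df cf] := Cf; have [dg cg] := Cg.
apply: (@C1_intro V R U _ (fun v x => f x * 'D_v g x + g x * 'D_v f x) oU).
- by move=> x Ux; apply: differentiableM; [exact: df|exact: dg].
- move=> v x Ux; apply: (@deriveM _ _ f g); apply: diff_derivable.
    exact: df.
  exact: dg.
- move=> v x Ux.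
  apply: (@continuousD _ _ _ (fun x => f x * 'D_v g x) (fun x => g x * 'D_v f x)).
    apply: (@continuousM _ _ f ('D_v g)); last exact: cg.
    exact: (C1_continuous Cf Ux).
  apply: (@continuousM _ _ g ('D_v f)); last exact: cf.
  exact: (C1_continuous Cg Ux).
Qed.

Lemma C1B V (U : set V) (f g : V -> R) : open U ->
  Ck_on U 1 f -> Ck_on U 1 g -> Ck_on U 1 (fun x => f x - g x).
Proof.
move=> oU Cf Cg.
have -> : (fun x => f x - g x) = (fun x => f x + cst (-1) x * g x).
  by apply/funext => x; rewrite /= mulN1r.
exact: (C1D oU Cf (C1M oU (C1_cst _ oU) Cg)).
Qed.

Lemma C1V V (U : set V) (f : V -> R) : open U ->
  (forall x, f x != 0) -> Ck_on U 1 f -> Ck_on U 1 (fun x => (f x)^-1).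
Proof.
move=> oU f0 Cf; have [df cDf] := Cf.
apply: (@C1_intro V R U _ (fun v x => - ((f x)^-1 * (f x)^-1) * 'D_v f x) oU).
- by move=> x Ux; apply: differentiableV; [exact: df|exact: f0].
- move=> v x Ux; rewrite -expr2 exprVn.
  have -> : 'D_v (fun x => (f x)^-1) x = - (f x) ^- 2 *: 'D_v f x.
    by apply: deriveV; [exact: f0|apply: diff_derivable; exact: df].
  by [].
- move=> v x Ux; have cf := C1_continuous Cf Ux.
  have cV : {for x, continuous (fun x => (f x)^-1)} by apply: continuousV.
  apply: (@continuousM _ _ (fun x => - ((f x)^-1 * (f x)^-1)) ('D_v f));
    last exact: cDf.
  apply: (@continuousN _ _ _ (fun x => (f x)^-1 * (f x)^-1)).
  exact: (@continuousM _ _ (fun x => (f x)^-1) (fun x => (f x)^-1) x cV cV).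
Qed.

Lemma derive_comp_real V (f : V -> R) (h : R -> R) (dh : R) (v x : V) :
  differentiable f x -> is_derive (f x) 1 h dh ->
  'D_v (h \o f) x = dh * 'D_v f x.
Proof.
move=> df dhx.
have dhf : differentiable h (f x) by apply/derivable1_diffP; exact: ex_derive.
rewrite !deriveE //; last exact: differentiable_comp.
rewrite diff_comp //= diff1E // derive1E derive_val.
by rewrite /GRing.scale /= mulrC.
Qed.

Lemma C1_comp_real V (U : set V) (f : V -> R) (h dh : R -> R) : open U ->
  (forall r : R, is_derive r (1 : R) h (dh r)) -> continuous dh ->
  Ck_on U 1 f -> Ck_on U 1 (h \o f).
Proof.
move=> oU hdh cdh Cf; have [df cDf] := Cf.
apply: (@C1_intro V R U _ (fun v x => dh (f x) * 'D_v f x) oU).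
- move=> x Ux; apply: differentiable_comp; first exact: df.
  by have [dhx _] := hdh (f x); exact/derivable1_diffP.
- by move=> v x Ux; apply: derive_comp_real; exact: df.
- move=> v x Ux; apply: (@continuousM _ _ (dh \o f) ('D_v f)); last exact: cDf.
  apply: continuous_comp; last exact: cdh.
  exact: (C1_continuous Cf Ux).
Qed.

Lemma C2_C1 V W (U : set V) (f : V -> W) :
  Ck_on U 2 f -> Ck_on U 1 f.
Proof.
move=> [df cf]; split; first exact: df.
by move=> v x Ux; apply: differentiable_continuous; have [d _] := cf v; exact: d.
Qed.

Lemma is_derive_C1 (k : R -> R) : Ck_on setT 1 k ->
  (forall r : R, is_derive r (1 : R) k ('D_1 k r)) /\ continuous ('D_1 k).
Proof.
move=> [dk ck]; split=> [r|r]; last exact: ck.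
by apply/derivableP/derivable1_diffP; exact: dk.
Qed.

Lemma derive_slice2 V1 V2 W (f : V1 * V2 -> W) t w q :
  'D_w (fun q => f (t, q)) q = 'D_((0, w) : V1 * V2) f (t, q).
Proof.
have E : (fun h : R => h^-1 *: (((fun q => f (t, q)) \o shift q) (h *: w)
     - f (t, q)))
   = (fun h : R => h^-1 *: ((f \o shift (t, q)) (h *: ((0, w) : V1 * V2))
     - f (t, q))).
  apply/funext => h /=; congr (_ *: (f _ - _)); congr (_, _).
  by rewrite /= scaler0 add0r.
by rewrite /derive E.
Qed.

Lemma is_derive_slice1 V1 V2 W (f : V1 * V2 -> W) t w q :
  differentiable f (t, q) ->
  is_derive t w (fun t => f (t, q)) ('D_((w, 0) : V1 * V2) f (t, q)).
Proof.
move=> df.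
have E : (fun h : R => h^-1 *: (((fun t => f (t, q)) \o shift t) (h *: w)
     - f (t, q)))
   = (fun h : R => h^-1 *: ((f \o shift (t, q)) (h *: ((w, 0) : V1 * V2))
     - f (t, q))).
  apply/funext => h /=.
  by congr (_ *: (f _ - _)); congr (_, _); rewrite /= scaler0 add0r.
have d := diff_derivable (v := ((w, 0) : V1 * V2)) df.
by apply: DeriveDef; [move: d; rewrite /derivable E|rewrite /derive E].
Qed.

Lemma differentiable_slice2 V1 V2 W (f : V1 * V2 -> W) t q :
  differentiable f (t, q) -> differentiable (fun q => f (t, q)) q.
Proof.
by move=> df; apply: (differentiable_comp (f := fun q => (t, q))).
Qed.

Lemma C2_slice2 V1 V2 W (f : V1 * V2 -> W) (I : set V1) t : I t ->
  Ck_on (I `*` setT) 2 f -> Ck_on setT 2 (fun q => f (t, q)).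
Proof.
have c q : {for q, continuous (fun q : V2 => (t, q))}.
  by apply: cvg_pair; [exact: cvg_cst|exact: cvg_id].
move=> It [df cf]; split.
  by move=> q _; apply: differentiable_slice2; apply: df.
move=> v; rewrite (_ : 'D_v _ = fun q => 'D_((0, v) : V1 * V2) f (t, q)); last first.
  by apply/funext => q; exact: derive_slice2.
have [df' cf'] := cf (0, v); split.
  move=> q _; have tq : (I `*` setT) (t, q) by [].
  exact: (@differentiable_slice2 _ _ _ ('D_((0, v) : V1 * V2) f) t q (df' _ tq)).
move=> w; rewrite (_ : 'D_w _ =
    fun q => 'D_((0, w) : V1 * V2) ('D_((0, v) : V1 * V2) f) (t, q)).
  move=> q _; have tq : (I `*` setT) (t, q) by [].
  exact: (@continuous_comp _ _ _ (fun q => (t, q))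
    ('D_((0, w) : V1 * V2) ('D_((0, v) : V1 * V2) f)) q (c q) (cf' _ _ tq)).
by apply/funext => q; exact: derive_slice2.
Qed.

Lemma derive_coord W (f : R * R -> W) (v q : R * R) :
  differentiable f q -> 'D_v f q =
    v.1 *: 'D_((1, 0) : R * R) f q + v.2 *: 'D_((0, 1) : R * R) f q.
Proof.
move=> df; have {1}-> : v = v.1 *: ((1, 0) : R * R) + v.2 *: ((0, 1) : R * R).
  by rewrite [LHS]surjective_pairing; congr (_, _);
    rewrite /= /GRing.scale /= ?mulr1 ?mulr0 ?addr0 ?add0r.
by rewrite !deriveE // linearD !linearZ.
Qed.

End C1.

(** * Symmetry of second derivatives *)

Section Schwarz.
Context {R : realType} {V : normedModType R}.
Implicit Types (f : V -> R) (x v w : V).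

Lemma is_derive_line f x v (s : R) : differentiable f (x + s *: v) ->
  is_derive s (1 : R) (fun s => f (x + s *: v)) ('D_v f (x + s *: v)).
Proof.
move=> df.
have E : (fun h : R => h^-1 *: (((fun s => f (x + s *: v)) \o shift s) (h *: (1 : R))
     - f (x + s *: v)))
   = (fun h : R => h^-1 *: ((f \o shift (x + s *: v)) (h *: v)
     - f (x + s *: v))).
  apply/funext => h /=; congr (_ *: (f _ - _)).
  by rewrite scalerDl [h *: 1]mulr1 addrCA.
have d := diff_derivable (v := v) df.
by apply: DeriveDef; [move: d; rewrite /derivable E|rewrite /derive E].
Qed.

Lemma MVT_closed (g dg : R -> R) (d : R) : 0 < d ->
  (forall s : R, is_derive s (1 : R) g (dg s)) ->
  exists2 c, 0 <= c <= d & g d - g 0 = dg c * d.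
Proof.
move=> d0 gdg; have [//|c] := @MVT_segment R g dg 0 d (ltW d0).
  by apply: derivable_within_continuous => s _; have [] := gdg s.
by rewrite in_itv /= subr0 => cd e; exists c.
Qed.

(** The mean value theorem in the direction v, then in the direction w. The left-hand
    side is symmetric in v and w, so it is d ^+ 2 times either mixed derivative. *)
Lemma second_difference f x v w (d : R) : 0 < d ->
  (forall y, differentiable f y) -> (forall y, differentiable ('D_v f) y) ->
  exists s t, [/\ 0 <= s <= d, 0 <= t <= d &
    f (x + d *: w + d *: v) - f (x + d *: v) - f (x + d *: w) + f x =
    d ^+ 2 * 'D_w ('D_v f) (x + s *: v + t *: w)].
Proof.
move=> d0 df ddf.
have [s sd gs] := @MVT_closed
  (fun s => f (x + d *: w + s *: v) - f (x + s *: v))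
  (fun s => 'D_v f (x + d *: w + s *: v) - 'D_v f (x + s *: v)) d d0 (fun s =>
   @is_deriveB _ _ _ _ _ _ _ _ _ (is_derive_line (df _)) (is_derive_line (df _))).
have [t td gt] := @MVT_closed
  (fun t => 'D_v f (x + s *: v + t *: w))
  (fun t => 'D_w ('D_v f) (x + s *: v + t *: w)) d d0 (fun t =>
   is_derive_line (ddf _)).
exists s, t; split => //.
move: gs gt; rewrite !scale0r !addr0 [x + d *: w + s *: v]addrAC => gs gt.
rewrite [_ ^+ 2 * _]mulrC expr2 mulrA -gt -gs; ring.
Qed.

Let split_norm (a b c e : R) :
  `|a - c| < e / 2 -> `|b - c| < e / 2 -> `|a - b| < e.
Proof.
move=> ac bc; rewrite [e]splitr; apply: le_lt_trans (ltrD ac bc).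
by rewrite [`|b - c|]distrC ler_distD.
Qed.

Lemma Schwarz f v w x : Ck_on setT 2 f ->
  'D_v ('D_w f) x = 'D_w ('D_v f) x.
Proof.
move=> [df c2].
have dF y : differentiable f y by exact: df.
have dD u y : differentiable ('D_u f) y by have [+ _] := c2 u; exact.
apply/eqP; rewrite -subr_eq0; apply/negP => /negP.
rewrite -normr_gt0; set A := 'D_v _ _; set B := 'D_w _ _.
set e := `|A - B| => e0.
have near_close u u' : exists2 r : R, 0 < r &
    forall y, `|y| < r -> `|'D_u ('D_u' f) x - 'D_u ('D_u' f) (x + y)| < e / 2.
  have [_ /(_ u x I) c] := c2 u'.
  move: c; rewrite /prop_for /continuous_at => /cvgr_dist_lt /(_ (e / 2)).
  rewrite divr_gt0 // => /(_ isT).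
  move=> /nbhs_normP[r /= r0 Hr]; exists r => // y yr.
  by apply: Hr; rewrite /= opprD addrA subrr sub0r normrN.
have [r1 r10 H1] := near_close v w; have [r2 r20 H2] := near_close w v.
(* d is so small that both mixed derivatives stay within e / 2 of their value
   at x on the whole parallelogram of the second difference. *)
pose r := Num.min r1 r2; have r0 : 0 < r by rewrite lt_min r10.
pose M := `|v| + `|w| + 1; have M0 : 0 < M by rewrite ltr_wpDl ?addr_ge0.
pose d := r / M; have d0 : 0 < d by rewrite divr_gt0.
have small (s t : R) : 0 <= s <= d -> 0 <= t <= d -> `|s *: v + t *: w| < r.
  move=> /andP[s0 sd] /andP[t0 td]; apply: le_lt_trans (ler_normD _ _) _.
  rewrite !normrZ !ger0_norm //.
  apply: (@le_lt_trans _ _ (d * (`|v| + `|w|))).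
    by rewrite mulrDr lerD // ler_wpM2r.
  rewrite -[X in _ < X](divfK (lt0r_neq0 M0)) -/d ltr_pM2l //.
  by rewrite /M ltrDl.
have [s [t [sd td E1]]] := second_difference x w d0 dF (dD v).
have [t' [s' [td' sd' E2]]] := second_difference x v d0 dF (dD w).
have E : 'D_w ('D_v f) (x + (s *: v + t *: w)) =
         'D_v ('D_w f) (x + (s' *: v + t' *: w)).
  have d2 : d ^+ 2 != 0 by rewrite expf_neq0 ?lt0r_neq0.
  rewrite [s' *: v + _]addrC !addrA; apply: (@mulfI R (d ^+ 2) d2).
  apply: etrans (esym E1) (etrans _ E2); rewrite [x + d *: w + _]addrAC.
  by congr (_ + _); rewrite [LHS]addrAC.
have h1 := small _ _ sd td; have h2 := small _ _ sd' td'.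
have b1 : `|A - 'D_v ('D_w f) (x + (s' *: v + t' *: w))| < e / 2.
  by apply: H1; apply: lt_le_trans h2 _; rewrite /r ge_min lexx.
have b2 : `|B - 'D_v ('D_w f) (x + (s' *: v + t' *: w))| < e / 2.
  by rewrite -E; apply: H2; apply: lt_le_trans h1 _; rewrite /r ge_min lexx orbT.
move: b1 b2; set C := 'D_v _ _ => b1 b2.
by have := split_norm b1 b2; rewrite -/e ltxx.
Qed.

End Schwarz.

(** * Integration in the plane of parameters *)

Section PlaneIntegral.
Context {R : realType}.
Local Notation leb := (@lebesgue_measure R).
Local Notation plane := (measurableTypeR R * measurableTypeR R)%type.
Local Notation mu2 := (leb \x leb)%E.

(** An open set is a countable union of squares with rational centre and radius
    1 / (n + 1), and each of these is a product of measurable sets. *)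
Lemma measurable_open2 (U : set (R * R)) :
  open U -> measurable (U : set plane).
Proof.
move=> oU.
pose rect (k : rat * rat * nat) : set (R * R) :=
  ball (ratr k.1.1 : R) k.2.+1%:R^-1 `*` ball (ratr k.1.2 : R) k.2.+1%:R^-1.
pose rectU k := if `[< rect k `<=` U >] then rect k else set0.
have -> : U = \bigcup_k rectU k.
  apply/seteqP; split => [p Up|p [k _]]; last first.
    by rewrite /rectU; case: asboolP => // + rp; apply.
  have /nbhs_ballP[e /= e0 eU] := open_nbhs_nbhs (conj oU Up).
  have [n ne] : exists n : nat, (n.+1%:R^-1 : R) < e / 2.
    have e20 : 0 < e / 2 by rewrite divr_gt0.
    have [n _ /(_ n (leqnn n)) ?] := near_infty_natSinv_lt (PosNum e20).
    by exists n.
  set d := n.+1%:R^-1 in ne; have d0 : 0 < d by rewrite invr_gt0.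
  have ratnear (x : R) : exists q : rat, `|ratr q - x| < d.
    have /rat_in_itvoo[q] : x - d < x + d by rewrite ltrBlDr -addrA ltrDl addr_gt0.
    by rewrite in_itv /= => xq; exists q; rewrite ltr_distl.
  have [q qp] := ratnear p.1; have [r rp] := ratnear p.2.
  exists (q, r, n) => //; rewrite /rectU; case: asboolP => [_|[]].
    by split => /=; rewrite /ball /=.
  move=> [x y] [/= xq yr]; apply: eU; split => /=; rewrite /ball /= in xq yr *.
    apply: le_lt_trans (ler_distD (ratr q) _ _) _.
    by rewrite [e]splitr ltrD // (lt_trans _ ne) // distrC.
  apply: le_lt_trans (ler_distD (ratr r) _ _) _.
  by rewrite [e]splitr ltrD // (lt_trans _ ne) // distrC.
apply: countable_bigcupT_measurable; first exact: countableP.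
move=> k; rewrite /rectU; case: ifP => // _.
by apply: measurableX; exact: measurable_ball.
Qed.

Lemma measurable_closed2 (C : set (R * R)) :
  closed C -> measurable (C : set plane).
Proof.
move=> cC; rewrite -[C]setCK; apply: measurableC.
by apply: measurable_open2; exact: closed_openC.
Qed.

Lemma measurable_compact2 (C : set (R * R)) :
  compact C -> measurable (C : set plane).
Proof.
by move=> cC; apply: measurable_closed2; apply: compact_closed => //;
  exact: norm_hausdorff.
Qed.

Lemma continuous2_measurable (D : set (R * R)) (f : R * R -> R) :
  measurable (D : set plane) -> continuous f ->
  measurable_fun (D : set plane) (f : plane -> R).
Proof.
move=> mD cf; apply: (measurability _ (RGenOInfty.measurableE R)).
move=> /= _ [_ [a ->]] <-; apply: measurableI => //.
apply: measurable_open2; apply: open_comp; first by move=> x _; exact: cf.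
exact: interval_open.
Qed.

Lemma compact2_box (C : set (R * R)) : compact C ->
  exists2 M : R, 0 < M & forall q, C q -> `|q.1| < M /\ `|q.2| < M.
Proof.
move=> /compact_bounded [M [_ HM]].
exists (`|M| + 2); first by rewrite ltr_wpDl.
move=> q Cq; have := HM (`|M| + 1) _ q Cq.
rewrite (le_lt_trans (ler_norm M)) ?ltrDl // => /(_ isT) qM.
have [q1 q2] : `|q.1| <= `|q| /\ `|q.2| <= `|q|.
  by rewrite prod_normE; split; rewrite le_max lexx ?orbT.
by split; [apply: le_lt_trans q1 _|apply: le_lt_trans q2 _];
  apply: le_lt_trans qM _; rewrite ltrD2l ltr1n.
Qed.

Lemma compact2_fin (C : set (R * R)) : compact C -> (mu2 C < +oo)%E.
Proof.
move=> cC; have [M M0 CM] := compact2_box cC.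
apply: (@le_lt_trans _ _ (mu2 (`[- M, M]%classic `*` `[- M, M]%classic : set plane))).
  apply: le_measure; rewrite ?inE; first exact: measurable_compact2.
    by apply: measurableX; exact: measurable_itv.
  move=> q /CM [q1 q2]; split; rewrite /= in_itv /=;
    by rewrite -ler_norml ltW.
pose I : set R := `[- M, M]%classic.
have l : (leb I < +oo)%E.
  by rewrite lebesgue_measure_itv /=; case: ifP => _; rewrite ?ltry // -EFinD ltry.
rewrite product_measure1E; [|exact: measurable_itv..].
apply: lte_mul_pinfty => //; apply: fin_real; rewrite l andbT.
by apply: lt_le_trans (measure_ge0 _ _); rewrite ltNy0.
Qed.

Lemma compact2_bounded (C : set (R * R)) (f : R * R -> R) : compact C ->
  continuous f -> exists2 M : R, 0 < M & forall q, C q -> `|f q| <= M.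
Proof.
move=> cC cf; have /compact_bounded [M [_ HM]] : compact (f @` C).
  by apply: continuous_compact => //; exact: continuous_subspaceT.
exists (`|M| + 1); first by rewrite ltr_wpDl.
move=> q Cq; apply: (HM (`|M| + 1)); last by exists q.
by rewrite (le_lt_trans (ler_norm M)) ?ltrDl.
Qed.

Lemma compact2_integrable (C : set (R * R)) (f : R * R -> R) :
  compact C -> continuous f ->
  mu2.-integrable (C : set plane) (EFin \o f : plane -> \bar R).
Proof.
move=> cC cf; have mC := measurable_compact2 cC.
apply: measurable_bounded_integrable => //; first exact: compact2_fin.
  exact: continuous2_measurable.
have [M M0 fM] := compact2_bounded cC cf.
exists M; split; first exact: num_real.
by move=> N MN q Cq; apply: le_trans (fM q Cq) (ltW MN).
Qed.

Lemma integral_derive_supported (h dh : R -> R) (M : R) : 0 < M ->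
  (forall s : R, is_derive s (1 : R) h (dh s)) -> continuous dh ->
  (forall s, M <= `|s| -> h s = 0) -> (forall s, M <= `|s| -> dh s = 0) ->
  (\int[leb]_x (dh x)%:E = 0)%E.
Proof.
move=> M0 hdh cdh h0 dh0.
have ch : continuous h.
  move=> s; apply: differentiable_continuous; apply/derivable1_diffP.
  by have [] := hdh s.
have -> : (\int[leb]_x (dh x)%:E = \int[leb]_(x in `[(- M)%R, M]%classic) (dh x)%:E)%E.
  rewrite [RHS]integral_mkcond; apply: eq_integral => s _.
  rewrite /patch; case: ifPn => //; rewrite notin_setE /= in_itv /= -ler_norml.
  by move/negP; rewrite -ltNge => /ltW /dh0 ->.
rewrite (@continuous_FTC2 _ dh h) ?gtrN //.
- by rewrite !h0 ?normrN ?(ger0_norm (ltW M0)) // sube0.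
- exact: continuous_subspaceT.
- split.
  + by move=> s _; have [] := hdh s.
  + by apply: cvg_at_right_filter; exact: ch.
  + by apply: cvg_at_left_filter; exact: ch.
- by move=> s _; rewrite derive1E; have [] := hdh s.
Qed.

Lemma derive_off_support (a : R * R -> R) (C : set (R * R)) v q :
  compact C -> (forall q, ~ C q -> a q = 0) -> ~ C q -> 'D_v a q = 0.
Proof.
move=> cC a0 nCq; have oC : open (~` C).
  by apply: closed_openC; apply: compact_closed => //; exact: norm_hausdorff.
rewrite (@near_eq_derive _ _ _ a (cst 0)) ?derive_cst //.
by apply: filterS (open_nbhs_nbhs (conj oC nCq)) => y; exact: a0.
Qed.

(** The divergence theorem for a compactly supported field along one axis, selected
    by i: Fubini's theorem reduces it to the fundamental theorem of calculus on the
    lines parallel to that axis, on which a vanishes outside a bounded interval. *)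
Lemma integral_derive_axis (i : bool) (a : R * R -> R) (C : set (R * R)) :
  let v : R * R := if i then (1, 0) else (0, 1) in
  Ck_on setT 1 a -> compact C -> (forall q, ~ C q -> a q = 0) ->
  \int[mu2]_(q in (C : set plane)) 'D_v a q = 0.
Proof.
move=> v [da ca] cC a0.
have da' q : differentiable a q by exact: da.
have ca' w : continuous ('D_w a) by move=> q; exact: ca.
have D0 w q : ~ C q -> 'D_w a q = 0 by exact: derive_off_support.
have [M M0 CM] := compact2_box cC.
have offC q : M <= `|q.1| \/ M <= `|q.2| -> ~ C q.
  by move=> + /CM [q1 q2]; rewrite !leNgt q1 q2 => -[].
have mC := measurable_compact2 cC.
have ig : mu2.-integrable (setT : set plane) (EFin \o 'D_v a : plane -> \bar R).
  rewrite (_ : EFin \o 'D_v a = (EFin \o 'D_v a : plane -> \bar R) \_ C).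
    by apply/(integrable_mkcond _ mC); exact: compact2_integrable.
  apply/funext => q; rewrite /patch; case: ifPn => //; rewrite notin_setE => nC.
  by rewrite /= D0.
rewrite /Rintegral.
suff -> : (\int[mu2]_(q in (C : set plane)) ('D_v a q)%:E = 0)%E by [].
have -> : (\int[mu2]_(q in (C : set plane)) ('D_v a q)%:E =
           \int[mu2]_q ((EFin \o 'D_v a : plane -> \bar R) q))%E.
  rewrite [LHS]integral_mkcond; apply: eq_integral => q _.
  rewrite /patch; case: ifPn => //; rewrite notin_setE => nC.
  by rewrite /= D0.
rewrite /v in ig *; case: i v ig => v ig.
- rewrite -integral21_prod_meas1 //; apply: integral0_eq => y _.
  apply: (@integral_derive_supported (fun x => a (x, y)) _ M) => //.
  + by move=> s; apply: is_derive_slice1.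
  + move=> s; have c : {for s, continuous (fun s : R => (s, y))}.
      by apply: differentiable_continuous; exact: differentiable_pair.
    exact: (@continuous_comp _ _ _ (fun s => (s, y)) _ s c (ca' _ _)).
  + by move=> s Ms; rewrite a0 //; apply: offC; left.
  + by move=> s Ms; rewrite D0 //; apply: offC; left.
- rewrite -integral12_prod_meas1 //; apply: integral0_eq => x _.
  apply: (@integral_derive_supported (fun y => a (x, y)) _ M) => //.
  + move=> s; rewrite -derive_slice2; apply/derivableP/derivable1_diffP.
    exact: differentiable_slice2.
  + move=> s; have c : {for s, continuous (fun s : R => (x, s))}.
      by apply: differentiable_continuous; exact: differentiable_pair.
    exact: (@continuous_comp _ _ _ (fun s => (x, s)) _ s c (ca' _ _)).
  + by move=> s Ms; rewrite a0 //; apply: offC; right.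
  + by move=> s Ms; rewrite D0 //; apply: offC; right.
Qed.

(** Simple zeros are isolated. Those with no other zero within distance 1 / (n + 1)
    are told apart by the integer part of (n + 1) s. *)
Lemma countable_simple_zeros (h dh : R -> R) :
  (forall s : R, is_derive s (1 : R) h (dh s)) ->
  countable [set s | h s = 0 /\ dh s <> 0].
Proof.
move=> hdh.
pose E (n : nat) := [set s | h s = 0 /\
  forall t, 0 < `|t| < n.+1%:R^-1 -> h (t + s) <> 0].
apply: (@sub_countable _ _ _ (\bigcup_n E n)).
  apply: subset_card_le => s [hs0 dhs].
  have [dr dv] := hdh s; move: dr; rewrite /derivable => dr.
  have : (fun t : R => t^-1 *: ((h \o shift s) (t *: 1) - h s)) @ (0 : R)^' --> dh s.
    by rewrite -dv.
  move=> /cvgr_neq0 /(_ (introN eqP dhs)).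
  move=> /nbhs_ballP[e /= e0 He].
  have [n _ /(_ n (leqnn n)) /= ne] := near_infty_natSinv_lt (PosNum e0).
  exists n => //; split => // t /andP[t0 tn] hts.
  have := He t; rewrite /ball /= sub0r normrN (lt_trans tn ne) => /(_ isT).
  rewrite -normr_gt0 t0 => /(_ isT); rewrite /= [t *: 1]mulr1 hts hs0 subrr.
  by rewrite scaler0 eqxx.
apply: bigcup_countable => // n _; apply/countable_injP.
exists (fun s => pickle (Num.floor (n.+1%:R * s))).
move=> s t; rewrite !inE => -[hs Hs] [ht Ht] /(pcan_inj pickleK) fst.
have [//|st] := eqVneq s t; exfalso.
apply: (Hs (t - s)); last by rewrite subrK.
rewrite normr_gt0 subr_eq0 eq_sym st /=.
have n0 : 0 < n.+1%:R :> R by [].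
rewrite -(ltr_pM2l n0) mulfV ?lt0r_neq0 // -[X in X * `|_|](ger0_norm (ltW n0)).
rewrite -normrM mulrBr.
have := floor_itv (n.+1%:R * s); rewrite fst.
have := floor_itv (n.+1%:R * t); rewrite intrD.
move: (n.+1%:R * s) (n.+1%:R * t) (_%:~R) => x y k /andP[h1 h2] /andP[h3 h4].
by rewrite ltr_norml; apply/andP; split; lra.
Qed.

(** Cavalieri's principle for lines parallel to the axis selected by i. *)
Lemma null_lines (i : bool) (N : set (R * R)) : measurable (N : set plane) ->
  (forall y, leb [set x | N (if i then (x, y) else (y, x))] = 0) ->
  mu2 (N : set plane) = 0%E.
Proof.
move=> mN N0; rewrite -[N in LHS]setIT -integral_indic //.
have m1 : measurable_fun setT (fun q : plane => ((\1_N q)%:E : \bar R)).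
  exact/measurable_EFinP/measurable_indic.
have p1 (q : plane) : (0 <= (\1_N q : R)%:E)%E by rewrite lee_fin.
case: i N0 => N0.
- rewrite fubini_tonelli2 //; apply: integral0_eq => y _.
  rewrite -(N0 y); have -> : [set x | N (x, y)] = ysection N y.
    by apply/seteqP; split => x; rewrite /ysection /= inE.
  rewrite -[ysection N y]setIT -integral_indic //; last exact: measurable_ysection.
  by apply: eq_integral => x _; rewrite !indicE /ysection mem_setE.
- rewrite fubini_tonelli1 //; apply: integral0_eq => x _.
  rewrite -(N0 x); have -> : [set y | N (x, y)] = xsection N x.
    by apply/seteqP; split => y; rewrite /xsection /= inE.
  rewrite -[xsection N x]setIT -integral_indic //; last exact: measurable_xsection.
  by apply: eq_integral => y _; rewrite !indicE /xsection mem_setE.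
Qed.

(** Where the i-th partial derivative is nonzero, every line parallel to the i-th
    axis meets the zero set in simple zeros of the restriction of f, hence in a
    countable set; the two axes together cover all zeros. *)
Lemma null_regular_zeros (f : R * R -> R) : Ck_on setT 1 f ->
  (forall q, f q = 0 -> exists v, 'D_v f q <> 0) ->
  mu2 ([set q | f q = 0] : set plane) = 0%E.
Proof.
move=> Cf nz; have [df cDf] := Cf.
have df' q : differentiable f q by exact: df.
have cf : continuous f by move=> q; exact: differentiable_continuous.
have mZ : measurable ([set q | f q = 0] : set plane).
  apply: measurable_closed2; rewrite (_ : mkset _ = f @^-1` [set 0]) //.
  exact: closed_comp.
have mN v : measurable ([set q | f q = 0 /\ 'D_v f q <> 0] : set plane).
  have cD : closed ('D_v f @^-1` [set 0]).
    by apply: closed_comp => // q _; exact: cDf.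
  exact: (measurableI _ _ mZ (measurableC (measurable_closed2 cD))).
pose e1 : R * R := (1, 0); pose e2 : R * R := (0, 1).
have N1 : mu2 ([set q | f q = 0 /\ 'D_e1 f q <> 0] : set plane) = 0%E.
  apply: (@null_lines true _ (mN e1)) => y; apply: countable_lebesgue_measure0.
  apply: (@countable_simple_zeros (fun x => f (x, y))) => s.
  exact: is_derive_slice1.
have N2 : mu2 ([set q | f q = 0 /\ 'D_e2 f q <> 0] : set plane) = 0%E.
  apply: (@null_lines false _ (mN e2)) => x; apply: countable_lebesgue_measure0.
  apply: (@countable_simple_zeros (fun y => f (x, y))) => s.
  rewrite -derive_slice2; apply/derivableP/derivable1_diffP.
  exact: differentiable_slice2.
apply/eqP; rewrite eq_le measure_ge0 andbT -[leRHS](adde0 0%E) -{1}N1 -N2.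
apply: le_trans (measureU2 _ _ _) => //.
apply: le_measure; rewrite ?inE //; first exact: measurableU.
move=> q /= fq0; have [v Dv] := nz q fq0.
have Dlin := derive_coord v (df' q).
have [E1|E1] := eqVneq ('D_e1 f q) 0; last by left; split=> //; exact/eqP.
by right; split => // E2; apply: Dv; rewrite Dlin -/e1 -/e2 E1 E2 !scaler0 addr0.
Qed.

End PlaneIntegral.

(** * The sub-Riemannian area density *)

Section Density.
Context {R : realType}.
Local Notation leb := (@lebesgue_measure R).
Local Notation plane := (measurableTypeR R * measurableTypeR R)%type.
Local Notation mu2 := (leb \x leb)%E.
Implicit Types (p v w : R * R * R).

(** The fluxes of X and of - sqrt 2 Y through the parallelogram spanned by v and w at
    p. The sign and the factor keep the formulas polynomial in the coordinates and
    in e^z, e^{-z}. *)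
Definition xflux v w : R := v.1.1 * w.1.2 - v.1.2 * w.1.1.
Definition yflux p v w : R :=
  expR p.2 * (v.1.2 * w.2 - v.2 * w.1.2) +
  expR (- p.2) * (v.1.1 * w.2 - v.2 * w.1.1).
Definition hdensity p v w : R := Num.sqrt (xflux v w ^+ 2 + yflux p v w ^+ 2 / 2).

Lemma gram_cross p v w :
  metric p v v * metric p w w - metric p v w ^+ 2 =
  metric p (cross p v w) (cross p v w).
Proof.
have e0 : expR p.2 != 0 by rewrite gt_eqF ?expR_gt0.
rewrite /metric /cross /= expRN; field.
exact: e0.
Qed.

Lemma metricZ p (k : R) v w : metric p (k *: v) w = k * metric p v w.
Proof. by rewrite /metric /= /GRing.scale /=; ring. Qed.

Lemma metric_ge0 p v : 0 <= metric p v v.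
Proof.
have -> : metric p v v =
  (expR (- p.2) * v.1.1) ^+ 2 + (expR p.2 * v.1.2) ^+ 2 + v.2 ^+ 2.
  by rewrite /metric; ring.
by rewrite !addr_ge0 ?sqr_ge0.
Qed.

Lemma metric_hproj p n :
  metric p (hproj p n) (hproj p n) =
  metric p n (frameX p) ^+ 2 + metric p n (frameY p) ^+ 2.
Proof.
have [XX YY _ XY _] := frame_orthonormal p; rewrite /hproj.
move: (metric p n (frameX p)) (metric p n (frameY p)) => x y.
have -> : metric p (x *: frameX p + y *: frameY p) (x *: frameX p + y *: frameY p)
  = x ^+ 2 * metric p (frameX p) (frameX p)
    + y ^+ 2 * metric p (frameY p) (frameY p)
    + 2 * x * y * metric p (frameX p) (frameY p).
  by rewrite /metric /= /GRing.scale /= /GRing.scale /=; ring.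
by rewrite XX YY XY; ring.
Qed.

Lemma metric_crossX p v w : metric p (cross p v w) (frameX p) = xflux v w.
Proof. by rewrite /metric /cross /frameX /xflux /=; ring. Qed.

Let sqr_invsqrt2 : ((Num.sqrt 2)^-1 : R) ^+ 2 = 2^-1.
Proof. by rewrite exprVn sqr_sqrtr. Qed.

Lemma metric_crossY p v w :
  metric p (cross p v w) (frameY p) = - yflux p v w / Num.sqrt 2.
Proof.
have e0 : expR p.2 != 0 by rewrite gt_eqF ?expR_gt0.
have s0 : Num.sqrt (2 : R) != 0 by rewrite sqrtr_eq0 -ltNge.
rewrite /metric /cross /frameY /yflux /= expRN; field.
by rewrite e0 s0.
Qed.

(** Bessel's inequality: the missing square is the component along T. *)
Lemma metric_cross_cross p v w :
  xflux v w ^+ 2 + yflux p v w ^+ 2 / 2 <= metric p (cross p v w) (cross p v w).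
Proof.
have e0 : expR p.2 != 0 by rewrite gt_eqF ?expR_gt0.
suff -> : metric p (cross p v w) (cross p v w) =
  xflux v w ^+ 2 + yflux p v w ^+ 2 / 2 +
  (expR p.2 * (v.1.2 * w.2 - v.2 * w.1.2) -
   expR (- p.2) * (v.1.1 * w.2 - v.2 * w.1.1)) ^+ 2 / 2.
  by rewrite lerDl divr_ge0 // sqr_ge0.
rewrite /metric /cross /xflux /yflux /= expRN; field.
exact: e0.
Qed.

(** The length of the cross product is both the area element and the factor that
    normalizes the normal, so it cancels, and what remains is the length of the
    horizontal part of the cross product. *)
Lemma sR_density (S : R * R -> R * R * R) q :
  mnorm (S q) (hproj (S q) (unit_normal S q)) * area_element S q =
  hdensity (S q) (tangent1 S q) (tangent2 S q).
Proof.
rewrite /area_element gram_cross -/(mnorm _ _) /unit_normal.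
set n := cross _ _ _; set k := mnorm (S q) n.
have k0 : 0 <= k by exact: sqrtr_ge0.
have kn : k ^+ 2 = metric (S q) n n.
  by rewrite sqr_sqrtr // metric_ge0.
have -> : mnorm (S q) (hproj (S q) (k^-1 *: n)) =
          k^-1 * hdensity (S q) (tangent1 S q) (tangent2 S q).
  rewrite /mnorm metric_hproj !metricZ metric_crossX metric_crossY.
  rewrite mulNr mulrN sqrrN !exprMn sqr_invsqrt2 -mulrDr sqrtrM ?sqr_ge0 //.
  by rewrite sqrtr_sqr ger0_norm ?invr_ge0.
have [kz|knz] := eqVneq k 0; last by rewrite mulrAC mulVf ?mul1r.
rewrite kz mulr0 /hdensity; apply/esym/eqP; rewrite sqrtr_eq0.
by apply: le_trans (metric_cross_cross _ _ _) _; rewrite -/n -kn kz expr0n.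
Qed.

Lemma sR_areaE (S : R * R -> R * R * R) C : sR_area S C =
  \int[mu2]_(q in (C : set plane)) hdensity (S q) (tangent1 S q) (tangent2 S q).
Proof. by rewrite /sR_area; apply: eq_Rintegral => q _; exact: sR_density. Qed.

Lemma yflux_le_hdensity p v w : `|yflux p v w| <= Num.sqrt 2 * hdensity p v w.
Proof.
rewrite /hdensity -sqrtrM // -sqrtr_sqr ler_wsqrtr //.
have -> : 2 * (xflux v w ^+ 2 + yflux p v w ^+ 2 / 2) =
  2 * xflux v w ^+ 2 + yflux p v w ^+ 2 by field.
by rewrite lerDr mulr_ge0 ?sqr_ge0.
Qed.

End Density.

(** * Calibrations by fields k(z) Y *)

Section C1flux.
Context {R : realType}.

Lemma fst_continuous (V W : normedModType R) :
  continuous (fst : {linear (V * W)%type -> V}).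
Proof. by move=> x; exact: cvg_fst. Qed.

Lemma snd_continuous (V W : normedModType R) :
  continuous (snd : {linear (V * W)%type -> W}).
Proof. by move=> x; exact: cvg_snd. Qed.

Section Components.
Variables (V : normedModType R) (U : set V) (A : V -> R * R * R).
Hypotheses (oU : open U) (CA : Ck_on U 1 A).

Lemma C1_x : Ck_on U 1 (fun q => (A q).1.1).
Proof.
exact: (C1_linear oU (@fst_continuous R R)
  (C1_linear oU (@fst_continuous (R * R)%type R) CA)).
Qed.

Lemma C1_y : Ck_on U 1 (fun q => (A q).1.2).
Proof.
exact: (C1_linear oU (@snd_continuous R R)
  (C1_linear oU (@fst_continuous (R * R)%type R) CA)).
Qed.

Lemma C1_z : Ck_on U 1 (fun q => (A q).2).
Proof. exact: (C1_linear oU (@snd_continuous (R * R)%type R) CA). Qed.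

End Components.

Section DeriveComponents.
Variables (V : normedModType R) (A : V -> R * R * R) (v q : V).
Hypothesis dA : differentiable A q.

Let dA1 : differentiable (fun q => (A q).1) q.
Proof.
apply: (@differentiable_comp _ _ _ _ A
  (fst : {linear (R * R * R)%type -> (R * R)%type})) => //.
exact: linear_differentiable (@fst_continuous _ _).
Qed.

Lemma differentiable_x : differentiable (fun q => (A q).1.1) q.
Proof.
apply: (@differentiable_comp _ _ _ _ (fun q => (A q).1)
  (fst : {linear (R * R)%type -> R})) => //.
exact: linear_differentiable (@fst_continuous _ _).
Qed.

Lemma differentiable_y : differentiable (fun q => (A q).1.2) q.
Proof.
apply: (@differentiable_comp _ _ _ _ (fun q => (A q).1)
  (snd : {linear (R * R)%type -> R})) => //.
exact: linear_differentiable (@snd_continuous _ _).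
Qed.

Lemma differentiable_z : differentiable (fun q => (A q).2) q.
Proof.
apply: (@differentiable_comp _ _ _ _ A
  (snd : {linear (R * R * R)%type -> R})) => //.
exact: linear_differentiable (@snd_continuous _ _).
Qed.

Let derive_1 : 'D_v (fun q => (A q).1) q = ('D_v A q).1.
Proof. exact: (derive_linear v (@fst_continuous _ _) dA). Qed.

Lemma derive_x : 'D_v (fun q => (A q).1.1) q = ('D_v A q).1.1 :> R.
Proof.
by rewrite -derive_1; exact: (derive_linear v (@fst_continuous _ _) dA1).
Qed.

Lemma derive_y : 'D_v (fun q => (A q).1.2) q = ('D_v A q).1.2 :> R.
Proof.
by rewrite -derive_1; exact: (derive_linear v (@snd_continuous _ _) dA1).
Qed.

Lemma derive_z : 'D_v (fun q => (A q).2) q = ('D_v A q).2 :> R.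
Proof. exact: (derive_linear v (@snd_continuous _ _) dA). Qed.

End DeriveComponents.

Lemma C2_z (V : normedModType R) (A : V -> R * R * R) :
  Ck_on setT 2 A -> Ck_on setT 2 (fun q => (A q).2).
Proof. exact: (C2_linear (@snd_continuous (R * R)%type R)). Qed.

Lemma is_derive_expRN (r : R) :
  is_derive r (1 : R) (fun r => expR (- r)) (- expR (- r)).
Proof.
rewrite -[X in is_derive _ _ _ X]mulrN1.
exact: (is_derive1_comp (is_derive_expR _) (is_deriveNid r 1)).
Qed.

Lemma C1_expR (V : normedModType R) (U : set V) (f : V -> R) : open U ->
  Ck_on U 1 f -> Ck_on U 1 (fun q => expR (f q)).
Proof.
move=> oU Cf.
exact: (C1_comp_real oU (@is_derive_expR R) (@continuous_expR R) Cf).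
Qed.

Lemma C1_expRN (V : normedModType R) (U : set V) (f : V -> R) : open U ->
  Ck_on U 1 f -> Ck_on U 1 (fun q => expR (- f q)).
Proof.
move=> oU Cf; apply: (C1_expR oU).
have -> : (fun q => - f q) = (fun q => cst 0 q - f q).
  by apply/funext => q; rewrite sub0r.
exact: (C1B oU (C1_cst _ oU) Cf).
Qed.

Lemma C1_xflux (V : normedModType R) (U : set V) (A B : V -> R * R * R) :
  open U -> Ck_on U 1 A -> Ck_on U 1 B ->
  Ck_on U 1 (fun q => xflux (A q) (B q)).
Proof.
move=> oU CA CB.
exact: (C1B oU (C1M oU (C1_x oU CA) (C1_y oU CB))
               (C1M oU (C1_y oU CA) (C1_x oU CB))).
Qed.

Lemma C1_yflux (V : normedModType R) (U : set V) (G A B : V -> R * R * R) :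
  open U -> Ck_on U 1 G -> Ck_on U 1 A -> Ck_on U 1 B ->
  Ck_on U 1 (fun q => yflux (G q) (A q) (B q)).
Proof.
move=> oU CG CA CB.
exact: (C1D oU
  (C1M oU (C1_expR oU (C1_z oU CG))
     (C1B oU (C1M oU (C1_y oU CA) (C1_z oU CB))
             (C1M oU (C1_z oU CA) (C1_y oU CB))))
  (C1M oU (C1_expRN oU (C1_z oU CG))
     (C1B oU (C1M oU (C1_x oU CA) (C1_z oU CB))
             (C1M oU (C1_z oU CA) (C1_x oU CB))))).
Qed.

Lemma continuous_hdensity (V : normedModType R) (G A B : V -> R * R * R) :
  Ck_on setT 1 G -> Ck_on setT 1 A -> Ck_on setT 1 B ->
  continuous (fun q => hdensity (G q) (A q) (B q)).
Proof.
move=> CG CA CB q; have oT : open (setT : set V) by exact: openT.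
have Cx := C1_xflux oT CA CB; have Cy := C1_yflux oT CG CA CB.
pose h q := xflux (A q) (B q) * xflux (A q) (B q) +
   yflux (G q) (A q) (B q) * yflux (G q) (A q) (B q) * cst (2^-1) q.
have Ch : Ck_on setT 1 h.
  exact: (C1D oT (C1M oT Cx Cx) (C1M oT (C1M oT Cy Cy) (C1_cst _ oT))).
have ch : {for q, continuous h} := C1_continuous Ch I.
exact: (@continuous_comp _ _ _ h Num.sqrt q ch (@sqrt_continuous R _)).
Qed.

End C1flux.

Section Calibration.
Context {R : realType}.
Local Notation leb := (@lebesgue_measure R).
Local Notation plane := (measurableTypeR R * measurableTypeR R)%type.
Local Notation mu2 := (leb \x leb)%E.
Local Notation e1 := ((1, 0) : R * R).
Local Notation e2 := ((0, 1) : R * R).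

Let oT : open (setT : set (R * R)). Proof. exact: openT. Qed.

(** The flux of - sqrt 2 k(z) Y through the parametrized surface S, as a density in
    the parameters. *)
Definition calib (k : R -> R) (S : R * R -> R * R * R) (q : R * R) : R :=
  k (S q).2 * yflux (S q) (tangent1 S q) (tangent2 S q).

(** A function W with dW /\ dz = k(z) (e^z dy + e^{-z} dx) /\ dz, the flux form of
    - sqrt 2 k(z) Y: the derivatives of the coefficients are multiples of dz. It
    exists for every k because Y is divergence-free and tangent to the level sets
    of z. *)
Definition potential (k : R -> R) (S : R * R -> R * R * R) (q : R * R) : R :=
  k (S q).2 * (expR (S q).2 * (S q).1.2 + expR (- (S q).2) * (S q).1.1).

Lemma C1_potential k dk S : (forall r : R, is_derive r (1 : R) k (dk r)) ->
  continuous dk -> Ck_on setT 1 S -> Ck_on setT 1 (potential k S).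
Proof.
move=> kdk cdk CS; have Cz := C1_z oT CS.
exact: (C1M oT (C1_comp_real oT kdk cdk Cz)
  (C1D oT (C1M oT (C1_expR oT Cz) (C1_y oT CS))
          (C1M oT (C1_expRN oT Cz) (C1_x oT CS)))).
Qed.

(** The term w dz of dW cancels in the product with dz. *)
Lemma derive_potential k dk S q : (forall r : R, is_derive r (1 : R) k (dk r)) ->
  differentiable S q -> exists w, forall v,
  'D_v (potential k S) q = w * ('D_v S q).2 +
  k (S q).2 * (expR (S q).2 * ('D_v S q).1.2 + expR (- (S q).2) * ('D_v S q).1.1).
Proof.
move=> kdk dS.
have dz := differentiable_z dS; have dx := differentiable_x dS.
have dy := differentiable_y dS.
pose z := (S q).2; pose x := (S q).1.1; pose y := (S q).1.2.
pose phi1 (r : R) := k r * expR r; pose phi2 (r : R) := k r * expR (- r).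
have d1 r : is_derive r (1 : R) phi1 (k r * expR r + expR r * dk r).
  exact: is_deriveM.
have d2 r : is_derive r (1 : R) phi2 (k r * - expR (- r) + expR (- r) * dk r).
  exact: (is_deriveM (kdk r) (is_derive_expRN r)).
exists ((k z * expR z + expR z * dk z) * y
        + (k z * - expR (- z) + expR (- z) * dk z) * x).
move=> v.
have -> : potential k S =
    (fun q => phi1 (S q).2 * (S q).1.2 + phi2 (S q).2 * (S q).1.1).
  by apply/funext => p; rewrite /potential /phi1 /phi2; ring.
have f1 : differentiable (fun q => phi1 (S q).2) q.
  apply: (@differentiable_comp _ _ _ _ (fun q => (S q).2) phi1) => //.
  by apply/derivable1_diffP; have [] := d1 (S q).2.
have f2 : differentiable (fun q => phi2 (S q).2) q.
  apply: (@differentiable_comp _ _ _ _ (fun q => (S q).2) phi2) => //.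
  by apply/derivable1_diffP; have [] := d2 (S q).2.
have g1 : differentiable (fun q => phi1 (S q).2 * (S q).1.2) q.
  exact: differentiableM.
have g2 : differentiable (fun q => phi2 (S q).2 * (S q).1.1) q.
  exact: differentiableM.
have -> : 'D_v (fun q => phi1 (S q).2 * (S q).1.2 + phi2 (S q).2 * (S q).1.1) q =
  'D_v (fun q => phi1 (S q).2 * (S q).1.2) q +
  'D_v (fun q => phi2 (S q).2 * (S q).1.1) q.
  exact: deriveD (diff_derivable g1) (diff_derivable g2).
have -> : 'D_v (fun q => phi1 (S q).2 * (S q).1.2) q =
  phi1 z * ('D_v S q).1.2 + y * 'D_v (fun q => phi1 (S q).2) q.
  rewrite -derive_y //; exact: (deriveM (diff_derivable f1) (diff_derivable dy)).
have -> : 'D_v (fun q => phi2 (S q).2 * (S q).1.1) q =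
  phi2 z * ('D_v S q).1.1 + x * 'D_v (fun q => phi2 (S q).2) q.
  rewrite -derive_x //; exact: (deriveM (diff_derivable f2) (diff_derivable dx)).
rewrite (derive_comp_real v dz (d1 _)) (derive_comp_real v dz (d2 _)) !derive_z //.
rewrite -/z /phi1 /phi2.
move: (('D_v S q).2) (('D_v S q).1.1) (('D_v S q).1.2) => zv xv yv.
ring.
Qed.

Lemma continuous_calib k dk S : (forall r : R, is_derive r (1 : R) k (dk r)) ->
  continuous dk -> Ck_on setT 2 S -> continuous (calib k S).
Proof.
move=> kdk cdk C2S; have CS := C2_C1 C2S; have [_ CD] := C2S.
have C := C1M oT (C1_comp_real oT kdk cdk (C1_z oT CS))
  (C1_yflux oT CS (CD e1) (CD e2)).
by move=> q; exact: (C1_continuous C I).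
Qed.

(** dW /\ dz = d(W dz) in the parameters; the second derivatives of z cancel by
    Schwarz's theorem. *)
Lemma calib_exact k dk S q : (forall r : R, is_derive r (1 : R) k (dk r)) ->
  continuous dk -> Ck_on setT 2 S ->
  calib k S q =
  'D_e1 (fun q => potential k S q * (tangent2 S q).2) q -
  'D_e2 (fun q => potential k S q * (tangent1 S q).2) q.
Proof.
move=> kdk cdk C2S; have CS := C2_C1 C2S; have [dS CD] := C2S.
have dSq p : differentiable S p by exact: dS.
have [dP _] := C1_potential kdk cdk CS.
have dW : differentiable (potential k S) q by exact: dP.
have dD v : differentiable (fun q => ('D_v S q).2) q.
  by apply: differentiable_z; have [d _] := CD v; exact: d.
have Dprod u v : 'D_u (fun q => potential k S q * ('D_v S q).2) q =
   potential k S q * 'D_u (fun q => ('D_v S q).2) q +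
   ('D_v S q).2 * 'D_u (potential k S) q.
  exact: (deriveM (diff_derivable dW) (diff_derivable (dD v))).
have DD u v : 'D_u (fun q => ('D_v S q).2) q = 'D_u ('D_v (fun q => (S q).2)) q.
  by congr ('D_u _ q); apply/funext => p; rewrite derive_z.
have [w Dw] := derive_potential kdk (dSq q).
have E1 := Dprod e1 e2; have E2 := Dprod e2 e1.
rewrite DD Dw in E1; rewrite DD -(Schwarz e1 e2 q (C2_z C2S)) Dw in E2.
apply: etrans _ (esym (congr2 (fun a b : R => a - b) E1 E2)); rewrite /=.
rewrite /calib /yflux /tangent1 /tangent2.
move: (potential k S q) ('D_e1 ('D_e2 _) q : R) => W D.
move: (k _) (expR _) (expR _) ('D_e1 S q) ('D_e2 S q) => r s t A B.
ring.
Qed.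

(** Stokes' theorem: the forms W dz of S1 and S0 differ by a form supported in C,
    whose differential integrates to zero. *)
Lemma calib_invariant k dk S0 S1 C :
  (forall r : R, is_derive r (1 : R) k (dk r)) -> continuous dk ->
  Ck_on setT 2 S0 -> Ck_on setT 2 S1 -> compact C ->
  (forall q, ~ C q -> S1 q = S0 q) ->
  \int[mu2]_(q in (C : set plane)) calib k S1 q =
  \int[mu2]_(q in (C : set plane)) calib k S0 q.
Proof.
move=> kdk cdk C2S0 C2S1 cC S10.
have oC : open (~` C).
  by apply: closed_openC; apply: compact_closed => //; exact: norm_hausdorff.
have D10 v q : ~ C q -> 'D_v S1 q = 'D_v S0 q.
  move=> nCq; apply: near_eq_derive.
  by apply: filterS (open_nbhs_nbhs (conj oC nCq)) => p; exact: S10.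
pose b v S (q : R * R) := potential k S q * ('D_v S q).2.
have Cb v S : Ck_on setT 2 S -> Ck_on setT 1 (b v S).
  move=> C2S; have [_ CD] := C2S.
  exact: (C1M oT (C1_potential kdk cdk (C2_C1 C2S)) (C1_z oT (CD v))).
have Cd v : Ck_on setT 1 (fun q => b v S1 q - b v S0 q).
  exact: (C1B oT (Cb _ _ C2S1) (Cb _ _ C2S0)).
have b0 v q : ~ C q -> b v S1 q - b v S0 q = 0.
  by move=> nCq; rewrite /b /potential S10 // D10 // subrr.
have I1 : \int[mu2]_(q in (C : set plane)) 'D_e1 (fun q => b e2 S1 q - b e2 S0 q) q = 0.
  exact: (@integral_derive_axis R true _ C (Cd e2) cC (b0 e2)).
have I2 : \int[mu2]_(q in (C : set plane)) 'D_e2 (fun q => b e1 S1 q - b e1 S0 q) q = 0.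
  exact: (@integral_derive_axis R false _ C (Cd e1) cC (b0 e1)).
have mC := measurable_compact2 cC.
have iD u v : mu2.-integrable (C : set plane)
    (EFin \o 'D_u (fun q => b v S1 q - b v S0 q) : plane -> \bar R).
  by apply: compact2_integrable => // q; have [_ c] := Cd v; exact: c.
have ic S : Ck_on setT 2 S ->
    mu2.-integrable (C : set plane) (EFin \o calib k S : plane -> \bar R).
  by move=> C2S; apply: compact2_integrable => //; exact: continuous_calib C2S.
apply/eqP; rewrite -subr_eq0 -RintegralB //; [|exact: ic..].
apply/eqP.
apply: etrans _ (etrans (congr2 (fun a b : R => a - b) I1 I2) (subrr (0 : R))).
rewrite -RintegralB //; [|exact: iD..].
apply: eq_Rintegral => q _; rewrite !(calib_exact _ kdk cdk) //.
have DB u v : 'D_u (fun q => b v S1 q - b v S0 q) q =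
    'D_u (b v S1) q - 'D_u (b v S0) q.
  apply: (@deriveB _ _ _ (b v S1) (b v S0)); apply: diff_derivable.
    by have [d _] := Cb v _ C2S1; exact: d.
  by have [d _] := Cb v _ C2S0; exact: d.
apply: etrans _ (esym (congr2 (fun a b : R => a - b) (DB e1 e2) (DB e2 e1))).
have swap (x y x' y' : R) : (x - y) - (x' - y') = (x - x') - (y - y') by ring.
exact: (swap ('D_e1 (b e2 S1) q) ('D_e2 (b e1 S1) q)
             ('D_e1 (b e2 S0) q) ('D_e2 (b e1 S0) q)).
Qed.

End Calibration.

(** * Vertical planes and their parametrizations *)

Section Sign.
Context {R : realType}.

Lemma constant_sign (V : normedModType R) (J : V -> R) :
  continuous J -> (forall q, J q != 0) ->
  exists2 s : R, `|s| = 1 & forall q, 0 < s * J q.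
Proof.
move=> cJ nJ; exists (Num.sg (J 0)); first by rewrite normr_sg nJ.
move=> q; rewrite ltNge; apply/negP => Jq.
pose g (t : R) := Num.sg (J 0) * J (t *: q).
have cg : continuous g.
  move=> t; have c : {for t, continuous (fun t : R => J (t *: q))}.
    exact: (@continuous_comp _ _ _ (fun t : R => t *: q) J t
      (@scalel_continuous _ _ q t) (cJ _)).
  have c' : {for t, continuous (fun=> Num.sg (J 0) : R)} by exact: cst_continuous.
  exact: (continuousM c' c).
have g0 : 0 < g 0 by rewrite /g scale0r -normrEsg normr_gt0.
have g1 : g 1 <= 0 by rewrite /g scale1r.
have [||t _ /eqP] := @IVT R g 0 1 0 ler01.
- exact: continuous_subspaceT.
- by rewrite ge_min g1 orbT /= le_max (ltW g0).
by rewrite mulf_eq0 sgr_eq0 !(negbTE (nJ _)).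
Qed.

(** The function tanh (r / 2). *)
Definition smooth_sign (r : R) : R := 1 - 2 * (1 + expR r)^-1.

Let den_gt0 (r : R) : 0 < 1 + expR r.
Proof. by rewrite addr_gt0 ?expR_gt0. Qed.

Lemma smooth_signN r : smooth_sign (- r) = - smooth_sign r.
Proof.
rewrite /smooth_sign expRN; field.
by rewrite ?gt_eqF ?expR_gt0 ?den_gt0 // addrC den_gt0.
Qed.

Lemma smooth_sign_le1 r : `|smooth_sign r| <= 1.
Proof.
have i0 : 0 <= (1 + expR r)^-1 by rewrite invr_ge0 ltW.
have i1 : (1 + expR r)^-1 <= 1 by rewrite invf_le1 // lerDl expR_ge0.
by rewrite ler_norml /smooth_sign; apply/andP; split; lra.
Qed.

(** For r >= 0 the defect r (1 - smooth_sign r) is 2 r / (1 + e^r) <= 2; the other case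
    follows by oddness. *)
Lemma smooth_sign_approx r : `|r| - 2 <= r * smooth_sign r.
Proof.
suff pos (t : R) : 0 <= t -> t - 2 <= t * smooth_sign t.
  have [r0|r0] := ger0P r; first exact: pos.
  by have := pos (- r); rewrite smooth_signN mulrNN oppr_ge0 => /(_ (ltW r0)).
move=> t0; rewrite /smooth_sign mulrBr mulr1 lerD2l lerN2.
rewrite mulrA ler_pdivrMr // mulrC ler_pM2l //.
have := expR_ge1Dx t; lra.
Qed.

Lemma C1_smooth_sign (V : normedModType R) (U : set V) (f : V -> R) : open U ->
  Ck_on U 1 f -> Ck_on U 1 (fun x => smooth_sign (f x)).
Proof.
move=> oU Cf.
have d0 x : 1 + expR (f x) != 0 by rewrite gt_eqF.
exact: (C1B oU (C1_cst (1 : R) oU) (C1M oU (C1_cst (2 : R) oU)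
  (C1V oU d0 (C1D oU (C1_cst (1 : R) oU) (C1_expR oU Cf))))).
Qed.

(** The limit of the hypothesis as m tends to infinity. *)
Lemma le_of_vanishing_error (A0 A1 K : R) : 0 <= K ->
  (forall m, 0 < m -> Num.sqrt 2 * A0 - 2 / m * K <= Num.sqrt 2 * A1) ->
  A0 <= A1.
Proof.
move=> K0 main; rewrite leNgt; apply/negP => A10.
have s2 : 0 < Num.sqrt (2 : R) by rewrite sqrtr_gt0.
pose d := Num.sqrt 2 * (A0 - A1).
have d0 : 0 < d by rewrite mulr_gt0 // subr_gt0.
(* For this m the error term is d * K / (K + 1), less than d. *)
have m0 : 0 < 2 * (K + 1) / d by rewrite divr_gt0 // mulr_gt0 // ltr_wpDl.
have := main _ m0.
have -> : 2 / (2 * (K + 1) / d) * K = d - d / (K + 1).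
  field; rewrite ?gt_eqF ?ltr_wpDl //.
have d1 : 0 < d / (K + 1) by rewrite divr_gt0 // ltr_wpDl.
move: d1; set t := d / _ => d1; rewrite /d; lra.
Qed.

End Sign.

Section PlaneVectors.
Context {R : realType}.
Variables (a b : R).
Hypothesis hab : a != 0 \/ b != 0.
Local Notation N := (a ^+ 2 + b ^+ 2).

(** - sqrt 2 times the value on Y of the conormal a dx + b dy of the plane, at height
    r: it vanishes exactly where the plane is tangent to the horizontal
    distribution. *)
Definition conormalY (r : R) : R := a * expR r - b * expR (- r).

(** The area of the projection of the parallelogram spanned by v and w to the
    coordinates b x - a y and z of the plane. *)
Definition plane_jac (v w : R * R * R) : R :=
  (b * v.1.1 - a * v.1.2) * w.2 - (b * w.1.1 - a * w.1.2) * v.2.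

Lemma ab_gt0 : 0 < N.
Proof.
by case: hab => h; [apply: ltr_pwDl|apply: ltr_wpDl];
  rewrite ?sqr_ge0 // exprn_even_gt0.
Qed.

Lemma xflux_plane (v w : R * R * R) :
  a * v.1.1 + b * v.1.2 = 0 -> a * w.1.1 + b * w.1.2 = 0 -> xflux v w = 0.
Proof.
rewrite /xflux; move: v w => [[x1 y1] z1] [[x2 y2] z2] /= E1 E2.
have Ea : a * (x1 * y2 - y1 * x2) = 0.
  transitivity ((a * x1 + b * y1) * y2 - (a * x2 + b * y2) * y1); first by ring.
  by rewrite E1 E2; ring.
have Eb : b * (x1 * y2 - y1 * x2) = 0.
  transitivity ((a * x2 + b * y2) * x1 - (a * x1 + b * y1) * x2); first by ring.
  by rewrite E1 E2; ring.
by case: hab => h; apply: (mulfI h); rewrite mulr0.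
Qed.

Lemma yflux_plane (p v w : R * R * R) :
  a * v.1.1 + b * v.1.2 = 0 -> a * w.1.1 + b * w.1.2 = 0 ->
  yflux p v w = - (conormalY p.2 * plane_jac v w / N).
Proof.
have N0 : N != 0 by rewrite gt_eqF ?ab_gt0.
rewrite /yflux /conormalY /plane_jac; move: (expR p.2) (expR (- p.2)) => e e'.
move: v w => [[x1 y1] z1] [[x2 y2] z2] /= E1 E2.
apply: (mulfI N0); rewrite mulrN mulrCA divff // mulr1.
apply/eqP; rewrite -subr_eq0; apply/eqP.
transitivity ((a * x1 + b * y1) * (e * b * z2 + e' * a * z2)
  - (a * x2 + b * y2) * (e * b * z1 + e' * a * z1)); first by ring.
by rewrite E1 E2; ring.
Qed.

Lemma plane_vec0 (v : R * R * R) : a * v.1.1 + b * v.1.2 = 0 ->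
  b * v.1.1 - a * v.1.2 = 0 -> v.2 = 0 -> v = 0.
Proof.
have N0 : N != 0 by rewrite gt_eqF ?ab_gt0.
move: v => [[x y] z] /= tv wv zv.
have x0 : x = 0.
  apply: (mulfI N0); rewrite mulr0.
  transitivity (a * (a * x + b * y) + b * (b * x - a * y)); first by ring.
  by rewrite tv wv; ring.
have y0 : y = 0.
  apply: (mulfI N0); rewrite mulr0.
  transitivity (b * (a * x + b * y) - a * (b * x - a * y)); first by ring.
  by rewrite tv wv; ring.
by rewrite x0 y0 zv.
Qed.

(** A zero determinant gives the relations with coefficients (w.2, - v.2) and
    (w', - v'), where v' and w' are the components of v and w along b x - a y;
    independence makes all four vanish, that is v = w = 0. *)
Lemma plane_jac_neq0 (v w : R * R * R) :
  a * v.1.1 + b * v.1.2 = 0 -> a * w.1.1 + b * w.1.2 = 0 ->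
  (forall s t : R, s *: v + t *: w = 0 -> s = 0 /\ t = 0) -> plane_jac v w != 0.
Proof.
move=> tv tw free; apply/eqP => J0.
have flat s t : s * (b * v.1.1 - a * v.1.2) + t * (b * w.1.1 - a * w.1.2) = 0 ->
    s * v.2 + t * w.2 = 0 -> s = 0 /\ t = 0.
  move=> hw hz; apply: free; apply: plane_vec0 => //=;
    rewrite /GRing.scale /= /GRing.scale /=.
    transitivity (s * (a * v.1.1 + b * v.1.2) + t * (a * w.1.1 + b * w.1.2)).
      by ring.
    by rewrite tv tw; ring.
  by rewrite -[RHS]hw; ring.
have [w2 /eqP v2] : w.2 = 0 /\ - v.2 = 0.
  by apply: flat; [rewrite -[RHS]J0 /plane_jac|]; ring.
rewrite oppr_eq0 in v2; move/eqP in v2.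
have [w1 /eqP v1] : b * w.1.1 - a * w.1.2 = 0 /\ - (b * v.1.1 - a * v.1.2) = 0.
  by apply: flat; rewrite ?w2 ?v2; ring.
rewrite oppr_eq0 in v1; move/eqP in v1.
have [/eqP] : (1 : R) = 0 /\ (0 : R) = 0 by apply: flat; rewrite ?v1 ?v2; ring.
by rewrite oner_eq0.
Qed.

End PlaneVectors.

Section PlaneParametrization.
Context {R : realType}.
Local Notation e1 := ((1, 0) : R * R).
Local Notation e2 := ((0, 1) : R * R).

Variables (a b c : R) (S : R * R -> R * R * R).
Hypothesis hab : a != 0 \/ b != 0.
Hypothesis C2S : Ck_on setT 2 S.
Hypothesis immS : immersion S.
Hypothesis inS : forall q, vplane a b c (S q).

Local Notation N := (a ^+ 2 + b ^+ 2).

Definition param_jac q := plane_jac a b (tangent1 S q) (tangent2 S q).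

Lemma differentiable_param q : differentiable S q.
Proof. by have [d _] := C2S; exact: d. Qed.

Lemma tangent_vplane v q : a * ('D_v S q).1.1 + b * ('D_v S q).1.2 = 0.
Proof.
have dx := diff_derivable (v := v) (differentiable_x (differentiable_param q)).
have dy := diff_derivable (v := v) (differentiable_y (differentiable_param q)).
rewrite -derive_x; last exact: differentiable_param.
rewrite -derive_y; last exact: differentiable_param.
have <- : 'D_v (fun q => a * (S q).1.1) q = a * 'D_v (fun q => (S q).1.1) q.
  exact: deriveZ.
have <- : 'D_v (fun q => b * (S q).1.2) q = b * 'D_v (fun q => (S q).1.2) q.
  exact: deriveZ.
have <- : 'D_v (fun q => a * (S q).1.1 + b * (S q).1.2) q =
  'D_v (fun q => a * (S q).1.1) q + 'D_v (fun q => b * (S q).1.2) q.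
  by apply: (deriveD (f := fun q => a * (S q).1.1) (g := fun q => b * (S q).1.2));
    exact: derivableZ.
have -> : (fun q => a * (S q).1.1 + b * (S q).1.2) = cst (- c).
  by apply/funext => p; apply/eqP; rewrite -addr_eq0; apply/eqP; exact: inS.
exact: derive_cst.
Qed.

Lemma xflux_vplane q : xflux (tangent1 S q) (tangent2 S q) = 0.
Proof. exact: (xflux_plane hab (tangent_vplane e1 q) (tangent_vplane e2 q)). Qed.

Lemma yflux_vplane q : yflux (S q) (tangent1 S q) (tangent2 S q) =
  - (conormalY a b (S q).2 * param_jac q / N).
Proof. exact: (yflux_plane hab (S q) (tangent_vplane e1 q) (tangent_vplane e2 q)). Qed.

Lemma param_jac_neq0 q : param_jac q != 0.
Proof.
apply: (plane_jac_neq0 hab (tangent_vplane e1 q) (tangent_vplane e2 q)).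
move=> s t st; have [_ inj] := immS q.
have /inj [] : 'd S q ((s, t) : R * R) = 'd S q 0; last by [].
rewrite linear0 -deriveE; last exact: differentiable_param.
by rewrite derive_coord; [exact: st|exact: differentiable_param].
Qed.

End PlaneParametrization.

(** * Vertical planes minimize area *)

Section Minimality.
Context {R : realType}.
Local Notation leb := (@lebesgue_measure R).
Local Notation plane := (measurableTypeR R * measurableTypeR R)%type.
Local Notation mu2 := (leb \x leb)%E.
Local Notation e1 := ((1, 0) : R * R).
Local Notation e2 := ((0, 1) : R * R).

Let oT : open (setT : set (R * R)). Proof. exact: openT. Qed.
Let oTR : open (setT : set R). Proof. exact: openT. Qed.

Variables (a b c : R) (S : R * R -> R * R * R).
Hypothesis hab : a != 0 \/ b != 0.
Hypothesis C2S : Ck_on setT 2 S.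
Hypothesis immS : immersion S.
Hypothesis inS : forall q, vplane a b c (S q).
Local Notation N := (a ^+ 2 + b ^+ 2).

Let CT v : Ck_on setT 1 ('D_v S).
Proof. by have [_ C] := C2S; exact: C. Qed.

Lemma C1_param_jac : Ck_on setT 1 (param_jac a b S).
Proof.
have L v : Ck_on setT 1 (fun q => b * ('D_v S q).1.1 - a * ('D_v S q).1.2).
  exact: (C1B oT (C1M oT (C1_cst b oT) (C1_x oT (CT v)))
                 (C1M oT (C1_cst a oT) (C1_y oT (CT v)))).
exact: (C1B oT (C1M oT (L e1) (C1_z oT (CT e2)))
               (C1M oT (L e2) (C1_z oT (CT e1)))).
Qed.

Lemma C1_conormalY (V : normedModType R) (U : set V) (f : V -> R) : open U ->
  Ck_on U 1 f -> Ck_on U 1 (fun x => conormalY a b (f x)).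
Proof.
move=> oU Cf.
exact: (C1B oU (C1M oU (C1_cst a oU) (C1_expR oU Cf))
               (C1M oU (C1_cst b oU) (C1_expRN oU Cf))).
Qed.

(** The calibration argument, with sg the sign of the Jacobian J of the
    parametrization and k = - sg * smooth_sign (m * conormalY). Since |k| <= 1, the
    density calib k is at most sqrt 2 times the area density on every surface. On the
    plane, sqrt 2 times the area density is |conormalY| * |J| / N and calib k is
    conormalY * smooth_sign (m * conormalY) * |J| / N, so the defect is at most
    2 / m * |J| / N. As calib k has the same integral on both surfaces, the area of
    S1 is at least that of S up to a multiple of 1 / m. *)
Lemma vplane_minimizing (S1 : R * R -> R * R * R) (C : set (R * R)) :
  Ck_on setT 2 S1 -> compact C -> (forall q, ~ C q -> S1 q = S q) ->
  sR_area S C <= sR_area S1 C.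
Proof.
move=> C2S1 cC S1S.
have mC := measurable_compact2 cC.
have int (f : R * R -> R) : continuous f ->
    mu2.-integrable (C : set plane) (EFin \o f : plane -> \bar R).
  exact: compact2_integrable.
have cJ : continuous (param_jac a b S).
  by move=> q; exact: (C1_continuous C1_param_jac I).
have [sg sg1 Jpos] := constant_sign cJ (param_jac_neq0 hab C2S immS inS).
have N0 := ab_gt0 hab.
pose h (S : R * R -> R * R * R) (q : R * R) :=
  hdensity (S q) (tangent1 S q) (tangent2 S q).
pose j q := `|param_jac a b S q| / N.
have ch (T : R * R -> R * R * R) : Ck_on setT 2 T -> continuous (h T).
  move=> C2T; have [_ CDT] := C2T.
  exact: (continuous_hdensity (C2_C1 C2T) (CDT e1) (CDT e2)).
have cj : continuous j.
  move=> q; have c1 : {for q, continuous (fun q => `|param_jac a b S q|)}.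
    exact: (@continuous_comp _ _ _ (param_jac a b S) (fun x : R => `|x|) q
      (cJ q) (@norm_continuous _ _ _)).
  have c2 : {for q, continuous (fun _ : R * R => N^-1 : R)} by exact: cst_continuous.
  exact: (continuousM c1 c2).
pose A0 := \int[mu2]_(q in (C : set plane)) h S q.
pose A1 := \int[mu2]_(q in (C : set plane)) h S1 q.
pose K := \int[mu2]_(q in (C : set plane)) j q.
have K0 : 0 <= K.
  by apply: Rintegral_ge0 => q _; rewrite divr_ge0 ?normr_ge0 // ltW.
have main (m : R) : 0 < m -> Num.sqrt 2 * A0 - 2 / m * K <= Num.sqrt 2 * A1.
  move=> m0.
  pose k (r : R) := - sg * smooth_sign (m * conormalY a b r).
  have Ck : Ck_on setT 1 k.
    exact: (C1M oTR (C1_cst (- sg) oTR) (C1_smooth_sign oTR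
      (C1M oTR (C1_cst m oTR) (C1_conormalY oTR (C1_id oTR))))).
  have [kdk cdk] := is_derive_C1 Ck.
  have k1 r : `|k r| <= 1.
    by rewrite /k normrM normrN sg1 mul1r smooth_sign_le1.
  have cc (T : R * R -> R * R * R) : Ck_on setT 2 T -> continuous (calib k T).
    by move=> C2T; exact: (continuous_calib kdk cdk C2T).
  have cM (r : R) (f : R * R -> R) : continuous f -> continuous (fun q => r * f q).
    move=> cf q; have c1 : {for q, continuous (fun _ : R * R => r : R)}.
      exact: cst_continuous.
    exact: (continuousM c1 (cf q)).
  have cB (f g : R * R -> R) : continuous f -> continuous g ->
      continuous (fun q => f q - g q).
    by move=> cf cg q; exact: (continuousB (cf q) (cg q)).
  have up : \int[mu2]_(q in (C : set plane)) calib k S1 q <= Num.sqrt 2 * A1.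
    rewrite /A1 -RintegralZl //; last exact: int (ch _ C2S1).
    apply: le_Rintegral => //;
      [exact: int (cc _ C2S1)|exact: int (cM _ _ (ch _ C2S1))|].
    move=> q _; apply: le_trans (ler_norm _) _; rewrite /calib normrM.
    apply: le_trans (yflux_le_hdensity _ _ _).
    by rewrite -[leRHS]mul1r ler_wpM2r.
  have low : Num.sqrt 2 * A0 - 2 / m * K <=
      \int[mu2]_(q in (C : set plane)) calib k S q.
    rewrite /A0 /K -RintegralZl //; last exact: int (ch _ C2S).
    rewrite -RintegralZl //; last exact: int cj.
    have i1 := int _ (cM (Num.sqrt 2) _ (ch _ C2S)).
    have i2 := int _ (cM (2 / m) _ cj).
    rewrite -RintegralB //.
    apply: le_Rintegral => //; [exact: int (cB _ _ (cM _ _ (ch _ C2S)) (cM _ _ cj))|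
      exact: int (cc _ C2S)|].
    move=> q _; rewrite /h /hdensity (xflux_vplane hab C2S inS) expr0n add0r.
    rewrite -sqrtrM // mulrC divfK // sqrtr_sqr /calib (yflux_vplane hab C2S inS).
    rewrite normrN /k /j; set s := conormalY _ _ _; set J := param_jac _ _ _ _.
    have -> : `|J| = sg * J.
      by rewrite -[LHS]mul1r -sg1 -normrM ger0_norm // ltW // Jpos.
    have app : `|s| - 2 / m <= s * smooth_sign (m * s).
      rewrite -(ler_pM2l m0) mulrBr [m * (2 / m)]mulrC divfK ?gt_eqF //.
      rewrite mulrA -{1}(ger0_norm (ltW m0)) -normrM; exact: smooth_sign_approx.
    have P : 0 < sg * J / N by rewrite divr_gt0 // Jpos.
    have -> : `|s * J / N| = `|s| * (sg * J / N).
      rewrite -mulrA normrM; congr (_ * _).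
      by rewrite -(ger0_norm (ltW P)) -mulrA [in RHS]normrM sg1 mul1r.
    have -> : - sg * smooth_sign (m * s) * - (s * J / N) =
        s * smooth_sign (m * s) * (sg * J / N) by ring.
    by rewrite -mulrBl ler_wpM2r // ltW.
  have eqW (x y : R) : x = y -> x <= y by move=> ->.
  apply: le_trans low (le_trans (eqW _ _ _) up); apply: esym.
  exact: (calib_invariant kdk cdk C2S C2S1 cC S1S).
have -> : sR_area S C = A0 := sR_areaE S C.
have -> : sR_area S1 C = A1 := sR_areaE S1 C.
exact: le_of_vanishing_error K0 main.
Qed.

(** The height is a submersion on the parametrized plane, and conormalY has only simple
    zeros: conormalY and its derivative together determine a and b. *)
Lemma null_singular_set :
  mu2 ([set q | conormalY a b (S q).2 = 0] : set plane) = 0%E.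
Proof.
apply: null_regular_zeros; first exact: (C1_conormalY oT (C1_z oT (C2_C1 C2S))).
move=> q s0.
have dz := differentiable_z (differentiable_param C2S q).
have ds (r : R) : is_derive r (1 : R) (conormalY a b) (a * expR r + b * expR (- r)).
  have := is_deriveB (is_deriveZ a (is_derive_expR r))
                     (is_deriveZ b (is_derive_expRN r)).
  by move=> H; apply: (is_derive_eq H); rewrite scalerN opprK.
have ds0 : a * expR (S q).2 + b * expR (- (S q).2) != 0.
  apply/eqP => t0; move: s0; rewrite /conormalY => s0.
  have E : expR (S q).2 != 0 by rewrite gt_eqF ?expR_gt0.
  have E' : expR (- (S q).2) != 0 by rewrite gt_eqF ?expR_gt0.
  have [a0 b0] : a = 0 /\ b = 0.
    split; [apply: (mulIf E)|apply: (mulIf E')]; rewrite mul0r; lra.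
  by case: hab; rewrite ?a0 ?b0 eqxx.
have Dv v : 'D_v (fun q => conormalY a b (S q).2) q =
    (a * expR (S q).2 + b * expR (- (S q).2)) * ('D_v S q).2.
  by rewrite (derive_comp_real v dz (ds _)) derive_z //; exact: differentiable_param.
apply: contrapT => nv.
have z0 v : ('D_v S q).2 = 0.
  apply/eqP; have [//|zv] := eqVneq ('D_v S q).2 0.
  exfalso; apply: nv; exists v; rewrite Dv => /eqP.
  by rewrite mulf_eq0 (negbTE ds0) (negbTE zv).
have /eqP := param_jac_neq0 hab C2S immS inS q; apply.
have tz1 : (tangent1 S q).2 = 0 := z0 e1.
have tz2 : (tangent2 S q).2 = 0 := z0 e2.
have pj0 (v w : R * R * R) : v.2 = 0 -> w.2 = 0 -> plane_jac a b v w = 0.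
  by rewrite /plane_jac => -> ->; ring.
exact: pj0 tz1 tz2.
Qed.

End Minimality.

(** * Functions of one variable with a minimum *)

Section Minimum.
Context {R : realType}.
Variables (A : R -> R) (e : R).
Hypotheses (e0 : 0 < e) (minA : forall t, `|t| < e -> A 0 <= A t).

(** Since 0 is a minimum, 0 <= A t - A 0 <= A t + A (- t) - 2 A 0. The symmetric
    quotient has limit 0 without any knowledge of the derivative, whereas the limit
    of the plain quotient would have to be identified. *)
Lemma is_derive_of_symmetric_quotient :
  (A t + A (- t) - 2 * A 0) / t @[t --> (0 : R)^'] --> (0 : R) ->
  is_derive (0 : R) (1 : R) A 0.
Proof.
move=> sym.
have q0 : (fun h : R => h^-1 *: ((A \o shift 0) (h *: 1) - A 0)) @ (0 : R)^'
    --> (0 : R).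
  apply/cvgr0Pnorm_lt => d d0.
  have /cvgr0Pnorm_lt /(_ d d0) near_sym := sym.
  near=> t.
  have te : `|t| < e.
    near: t; apply: nbhs_dnbhs; apply/nbhs_normP; exists e => //= t.
    by rewrite /= sub0r normrN.
  have sd : `|(A t + A (- t) - 2 * A 0) / t| < d by near: t.
  apply: le_lt_trans sd; rewrite /= addr0 [t *: 1]mulr1 /GRing.scale /= mulrC.
  rewrite !normrM ler_wpM2r ?normr_ge0 //.
  have mt := minA te; have mNt : A 0 <= A (- t) by apply: minA; rewrite normrN.
  by rewrite !ger0_norm; lra.
apply: DeriveDef; first by apply/cvg_ex; exists (0 : R).
exact: (cvg_lim (@Rhausdorff R) q0).
Unshelve. all: by end_near. Qed.

Hypothesis dA : is_derive (0 : R) (1 : R) A 0.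

(** A negative limit of A' t / t would make A strictly decreasing to the right of the
    minimum 0. *)
Lemma second_derivative_ge0_of_min : second_derivative_ge0 A.
Proof.
have A'0 : derive1 A 0 = 0 by rewrite derive1E; exact: derive_val.
split=> [l [nd]|].
  rewrite A'0 => cl; rewrite leNgt; apply/negP => l0.
  have /cl : nbhs l [set x : \bar R | (x < 0)%E].
    by apply: open_nbhs_nbhs; split => //; exact: open_ereal_lt_ereal.
  rewrite nbhs_filterE /= => nl.
  have /nbhs_ballP [r1 /= r10 H1] := nl.
  have /nbhs_ballP [r2 /= r20 H2] := nd.
  pose r := Num.min (Num.min r1 r2) e; have r0 : 0 < r by rewrite !lt_min r10 r20.
  pose d := r / 2; have d0 : 0 < d by rewrite divr_gt0.
  have dr : d < r by rewrite /d ltr_pdivrMr // ltr_pMr // ltr1n.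
  have dd (t : R) : 0 <= t <= d ->
    [/\ derivable A t 1, `|t| < e & 0 < t -> derive1 A t < 0].
    move=> /andP[t0 td]; have : t < r by apply: le_lt_trans dr.
    rewrite !lt_min => /andP[/andP[tr1 tr2] te]; split.
    - by apply: H2; rewrite /ball /= sub0r normrN ger0_norm.
    - by rewrite ger0_norm.
    - move=> tp; have := H1 t; rewrite /ball /= sub0r normrN ger0_norm //.
      move=> /(_ tr1 (lt0r_neq0 tp)); rewrite subr0 lte_fin.
      by rewrite pmulr_llt0 // invr_gt0.
  have [|||x] := @MVT R A (fun t => derive1 A t) 0 d.
  - exact: d0.
  - move=> x; rewrite in_itv /= => /andP[x0 xd].
    have [|dx _ _] := dd x; first by rewrite !ltW.
    by rewrite derive1E; exact/derivableP.
  - apply: derivable_within_continuous => x; rewrite in_itv /= => xd.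
    by have [] := dd x xd.
  - rewrite in_itv /= => /andP[x0 xd]; rewrite subr0 => E.
    have [|_ _ /(_ x0) neg] := dd x; first by rewrite !ltW.
    have [|_ de _] := dd d; first by rewrite lexx ltW.
    have := minA de; rewrite -subr_ge0 E leNgt => /negP; apply.
    by rewrite nmulr_rlt0.
rewrite /lower_second_derivative limf_einfE.
pose V : set R := [set t | `|t| < e].
have nV : (0 : R)^' V.
  apply: nbhs_dnbhs; apply/nbhs_normP; exists e => //= t.
  by rewrite /= sub0r normrN.
apply: le_trans (ereal_sup_ubound _); last by exists V; [exact: nV|reflexivity].
apply: le_ereal_inf_tmp => _ [t Vt <-].
by rewrite lee_fin A'0 mul0r subr0 divr_ge0 ?sqr_ge0 // mulr_ge0 // subr_ge0 minA.
Qed.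

End Minimum.

(** * Area densities along a variation *)

Section Variation.
Context {R : realType}.
Local Notation leb := (@lebesgue_measure R).
Local Notation plane := (measurableTypeR R * measurableTypeR R)%type.
Local Notation mu2 := (leb \x leb)%E.
Local Notation e1 := ((1, 0) : R * R).
Local Notation e2 := ((0, 1) : R * R).

Variables (e : R) (C : set (R * R)).
Hypotheses (e0 : 0 < e) (cC : compact C).

Local Notation strip := (`]- e, e[%classic `*` (setT : set (R * R))).

Lemma open_strip : open (strip : set (R * (R * R))).
Proof.
rewrite openE => -[t q] [/= te _]; exists (`]- e, e[%classic, setT) => //=.
split; last exact: filterT.
by apply: open_nbhs_nbhs; split => //; exact: interval_open.
Qed.

(** The time derivative is bounded on the compact set of times |t| <= e / 2 and
    parameters in C. *)
Lemma strip_lipschitz (f : R * (R * R) -> R) : Ck_on strip 1 f ->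
  exists2 M : R, 0 <= M & forall q t, C q -> `|t| < e / 2 ->
    `|f (t, q) - f (0, q)| <= M * `|t|.
Proof.
move=> [df cDf]; pose g := 'D_((1, 0) : R * (R * R)) f.
have e2e : e / 2 < e by rewrite ltr_pdivrMr // ltr_pMr // ltr1n.
pose B : set (R * (R * R)) := `[- (e / 2), e / 2]%classic `*` C.
have Bstrip : B `<=` strip.
  move=> [t q] [/= tB _]; split => //=; move: tB; rewrite !in_itv /=.
  by move=> /andP[h1 h2]; apply/andP; split; [apply: lt_le_trans h1; rewrite ltrN2|
    apply: le_lt_trans h2 _].
have cB : compact B by apply: compact_setX => //; exact: segment_compact.
have : compact (g @` B).
  apply: continuous_compact => //; apply: continuous_in_subspaceT => x.
  by rewrite inE => /Bstrip; exact: cDf.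
move=> /compact_bounded [M [_ HM]].
have gM x : B x -> `|g x| <= `|M| + 1.
  move=> Bx; apply: (HM (`|M| + 1)); last by exists x.
  by rewrite (le_lt_trans (ler_norm M)) ?ltrDl.
exists (`|M| + 1); first by rewrite addr_ge0.
move=> q t Cq te.
have inB (s : R) : `|s| < e / 2 -> B (s, q).
  by move=> se; split => //=; rewrite in_itv /= -ler_norml ltW.
have d (s : R) : `|s| < e / 2 -> is_derive s (1 : R) (fun s => f (s, q)) (g (s, q)).
  by move=> se; apply: is_derive_slice1; apply: df; apply: Bstrip; exact: inB.
have mvt (x y : R) : `|x| < e / 2 -> `|y| < e / 2 -> x <= y ->
    `|f (y, q) - f (x, q)| <= (`|M| + 1) * (y - x).
  move=> xe ye xy.
  have bet (s : R) : x <= s <= y -> `|s| < e / 2.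
    move: xe ye; rewrite !ltr_norml => /andP[h1 h2] /andP[h3 h4] /andP[h5 h6].
    by apply/andP; split; [apply: lt_le_trans h5|apply: le_lt_trans h4].
  have [||s sxy ->] := @MVT_segment R (fun s => f (s, q)) (fun s => g (s, q)) x y xy.
  - move=> s; rewrite in_itv /= => /andP[h1 h2]; apply: d; apply: bet.
    by rewrite !ltW.
  - apply: derivable_within_continuous => s; rewrite in_itv /= => h.
    by have [] := d s (bet s h).
  - rewrite normrM [`|y - x|]ger0_norm ?subr_ge0 // ler_wpM2r ?subr_ge0 //.
    by apply: gM; apply: inB; apply: bet; move: sxy; rewrite in_itv.
have z0 : `|0 : R| < e / 2 by rewrite normr0 divr_gt0.
have [t0|t0] := ger0P t.
  by have := mvt 0 t z0 te t0; rewrite subr0.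
by have := mvt t 0 te z0 (ltW t0); rewrite sub0r distrC.
Qed.

(** The Euclidean norm of (x, y / sqrt 2) obeys the triangle inequality and is at most
    |x| + |y|. *)
Lemma hnorm_lipschitz (x y x' y' : R) :
  `|Num.sqrt (x ^+ 2 + y ^+ 2 / 2) - Num.sqrt (x' ^+ 2 + y' ^+ 2 / 2)|
  <= `|x - x'| + `|y - y'|.
Proof.
have half (u v u' v' : R) : Num.sqrt (u ^+ 2 + v ^+ 2 / 2) <=
    Num.sqrt (u' ^+ 2 + v' ^+ 2 / 2) + (`|u - u'| + `|v - v'|).
  set r := Num.sqrt (u' ^+ 2 + _).
  have r0 : 0 <= r by exact: sqrtr_ge0.
  have r2 : r ^+ 2 = u' ^+ 2 + v' ^+ 2 / 2.
    by rewrite sqr_sqrtr // addr_ge0 ?divr_ge0 ?sqr_ge0.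
  have ur : `|u'| <= r.
    by rewrite -sqrtr_sqr ler_wsqrtr // lerDl divr_ge0 ?sqr_ge0.
  have vr : `|v'| <= 2 * r.
    rewrite -(@ler_pXn2r _ 2) ?nnegrE ?mulr_ge0 //.
    rewrite real_normK ?num_real // exprMn r2.
    by have := sqr_ge0 u'; have := sqr_ge0 v'; lra.
  have s0 : 0 <= r + (`|u - u'| + `|v - v'|) by rewrite !addr_ge0.
  rewrite -[leRHS](ger0_norm s0) -sqrtr_sqr ler_wsqrtr //.
  have Eu : u = u' + (u - u') by ring.
  have Ev : v = v' + (v - v') by ring.
  rewrite {1}Eu {1}Ev; move: (u - u') (v - v') => a b.
  have ha : u' * a <= r * `|a|.
    by apply: le_trans (ler_norm _) _; rewrite normrM ler_wpM2r.
  have hb : v' * b <= 2 * r * `|b|.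
    by apply: le_trans (ler_norm _) _; rewrite normrM ler_wpM2r.
  have na : `|a| ^+ 2 = a ^+ 2 by rewrite real_normK ?num_real.
  have nb : `|b| ^+ 2 = b ^+ 2 by rewrite real_normK ?num_real.
  have ab : 0 <= `|a| * `|b| by rewrite mulr_ge0.
  have b2 : 0 <= b ^+ 2 by exact: sqr_ge0.
  have -> : (r + (`|a| + `|b|)) ^+ 2 = r ^+ 2 + 2 * (r * `|a|) + 2 * r * `|b| +
    `|a| ^+ 2 + `|b| ^+ 2 + 2 * (`|a| * `|b|) by ring.
  have -> : (u' + a) ^+ 2 + (v' + b) ^+ 2 / 2 = u' ^+ 2 + v' ^+ 2 / 2 +
    2 * (u' * a) + v' * b + a ^+ 2 + b ^+ 2 / 2 by field.
  rewrite na nb r2; lra.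
rewrite ler_norml; apply/andP; split.
  have := half x' y' x y; rewrite [`|x' - x|]distrC [`|y' - y|]distrC; lra.
have := half x y x' y'; lra.
Qed.

Variable (F : R -> R * R -> R * R * R).
Let G (x : R * (R * R)) := F x.1 x.2.
Hypothesis C2F : Ck_on strip 2 G.
Let P (x : R * (R * R)) : R :=
  xflux ('D_((0, e1) : R * (R * R)) G x) ('D_((0, e2) : R * (R * R)) G x).
Let Q (x : R * (R * R)) : R :=
  yflux (G x) ('D_((0, e1) : R * (R * R)) G x) ('D_((0, e2) : R * (R * R)) G x).

Let CP : Ck_on strip 1 P.
Proof. by have [_ CD] := C2F; exact: (C1_xflux open_strip (CD _) (CD _)). Qed.

Let CQ : Ck_on strip 1 Q.
Proof.
have [_ CD] := C2F.
exact: (C1_yflux open_strip (C2_C1 C2F) (CD _) (CD _)).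
Qed.

Definition vdensity (t : R) (q : R * R) : R :=
  hdensity (F t q) (tangent1 (F t) q) (tangent2 (F t) q).

Lemma vdensityE t q : vdensity t q = Num.sqrt (P (t, q) ^+ 2 + Q (t, q) ^+ 2 / 2).
Proof.
rewrite /vdensity /hdensity /P /Q.
by rewrite -(derive_slice2 G t e1 q) -(derive_slice2 G t e2 q).
Qed.

Lemma C2_varied t : `|t| < e -> Ck_on setT 2 (F t).
Proof.
move=> te; have It : (`]- e, e[%classic : set R) t by rewrite /= in_itv /= -ltr_norml.
exact: (C2_slice2 It C2F).
Qed.

Lemma continuous_vdensity t : `|t| < e -> continuous (vdensity t).
Proof.
move=> /C2_varied C2; have [_ CD] := C2.
exact: (continuous_hdensity (C2_C1 C2) (CD e1) (CD e2)).
Qed.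

Lemma vdensity_lipschitz : exists2 M : R, 0 <= M & forall q t, C q -> `|t| < e / 2 ->
    `|vdensity t q - vdensity 0 q| <= M * `|t|.
Proof.
have [MP MP0 HP] := strip_lipschitz CP; have [MQ MQ0 HQ] := strip_lipschitz CQ.
exists (MP + MQ); first by rewrite addr_ge0.
move=> q t Cq te; rewrite !vdensityE; apply: le_trans (hnorm_lipschitz _ _ _ _) _.
by rewrite mulrDl lerD ?HP ?HQ.
Qed.

(** The square root is differentiable off zero; where the density vanishes at time 0,
    the density may have a corner. *)
Lemma derivable_vdensity q : vdensity 0 q != 0 ->
  derivable (fun t => vdensity t q) (0 : R) (1 : R).
Proof.
rewrite vdensityE => n0.
have s0 : strip (0 : R, q) by split => //=; rewrite in_itv /= oppr_lt0 e0.
have [dP _] := CP; have [dQ _] := CQ.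
have [dp _] := is_derive_slice1 (1 : R) (dP _ s0).
have [dq _] := is_derive_slice1 (1 : R) (dQ _ s0).
pose w (t : R) := P (t, q) ^+ 2 + 2^-1 * Q (t, q) ^+ 2.
have dw : derivable w (0 : R) (1 : R).
  have dpp : derivable (fun t => P (t, q) ^+ 2) (0 : R) (1 : R).
    exact: (derivableX (n := 2) dp).
  have dqq : derivable (fun t => Q (t, q) ^+ 2) (0 : R) (1 : R).
    exact: (derivableX (n := 2) dq).
  have dqq' : derivable (fun t => 2^-1 * Q (t, q) ^+ 2) (0 : R) (1 : R).
    exact: (derivableZ dqq).
  exact: (derivableD dpp dqq').
have w0 : 0 < w 0.
  have wge : 0 <= w 0.
    by rewrite /w addr_ge0 ?sqr_ge0 // mulr_ge0 ?invr_ge0 ?sqr_ge0.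
  rewrite lt_neqAle wge andbT eq_sym; apply: contra n0 => /eqP wz.
  by rewrite [_ / 2]mulrC -/(w 0) wz sqrtr0.
have E : Num.sqrt \o w = (fun t => vdensity t q).
  by apply/funext => t; rewrite vdensityE /= /w [_ / 2]mulrC.
have [h _] := is_derive1_comp (is_derive1_sqrt w0) (derivableP dw).
by rewrite E in h; exact: h.
Qed.

Let sym_id (x y z u : R) : u != 0 ->
  (x - z) / u - (y - z) / - u = (x + y - 2 * z) / u.
Proof. by move=> u0; field. Qed.

Lemma symmetric_quotient_vdensity q : vdensity 0 q != 0 ->
  (vdensity t q + vdensity (- t) q - 2 * vdensity 0 q) / t
    @[t --> (0 : R)^'] --> (0 : R).
Proof.
move=> n0; have d := derivable_vdensity n0.
pose Q0 (h : R) := h^-1 *: (((fun t => vdensity t q) \o shift 0) (h *: 1)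
  - vdensity 0 q).
pose D := lim (Q0 @ (0 : R)^').
have cD : (vdensity t q - vdensity 0 q) / t @[t --> (0 : R)^'] --> D.
  rewrite (_ : (fun t => _) = Q0); first exact: d.
  by apply/funext => t; rewrite /Q0 /= addr0 [t *: 1]mulr1 /GRing.scale /= mulrC.
apply/cvgr_dnbhsP => u [u0 cu].
have c1 := (cvgr_dnbhsP _ _ _).1 cD u (conj u0 cu).
have cNu : - u n @[n --> \oo] --> (0 : R) by rewrite -oppr0; exact: cvgN.
have Nu0 n : - u n != 0 by rewrite oppr_eq0.
have c2 := (cvgr_dnbhsP _ _ _).1 cD (fun n => - u n) (conj Nu0 cNu).
have c : (vdensity (u n) q - vdensity 0 q) / u n
    - (vdensity (- u n) q - vdensity 0 q) / - u n
    @[n --> \oo] --> D - D by exact: cvgB c1 c2.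
rewrite subrr in c.
have E n : (vdensity (u n) q + vdensity (- u n) q - 2 * vdensity 0 q) / u n =
    (vdensity (u n) q - vdensity 0 q) / u n
    - (vdensity (- u n) q - vdensity 0 q) / - u n.
  by rewrite sym_id.
by rewrite (funext E).
Qed.

End Variation.

(** * Differentiability of the area *)

Lemma Rintegral_symmetric d (T : measurableType d) (R : realType)
  (mu : {measure set T -> \bar R}) (C : set T) (f g h : T -> R) (r : R) :
  measurable C -> mu.-integrable C (EFin \o f) ->
  mu.-integrable C (EFin \o g) -> mu.-integrable C (EFin \o h) ->
  \int[mu]_(x in C) (r * (f x + g x - 2 * h x)) =
  r * (\int[mu]_(x in C) f x + \int[mu]_(x in C) g x
       - 2 * \int[mu]_(x in C) h x).
Proof.
move=> mC fi gi hi.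
have fgi : mu.-integrable C (EFin \o (fun x => f x + g x)).
  exact: (integrableD mC fi gi).
have h2i : mu.-integrable C (EFin \o (fun x => 2 * h x)).
  exact: (integrableZl mC 2 hi).
have si : mu.-integrable C (EFin \o (fun x => f x + g x - 2 * h x)).
  exact: (integrableB mC fgi h2i).
by rewrite RintegralZl // RintegralB // RintegralD // RintegralZl.
Qed.

Section AreaDerivative.
Context {R : realType}.
Local Notation leb := (@lebesgue_measure R).
Local Notation plane := (measurableTypeR R * measurableTypeR R)%type.
Local Notation mu2 := (leb \x leb)%E.

Variables (e : R) (C : set (R * R)) (F : R -> R * R -> R * R * R).
Hypotheses (e0 : 0 < e) (cC : compact C).
Hypothesis C2F : Ck_on (`]- e, e[%classic `*` (setT : set (R * R))) 2
  (fun x : R * (R * R) => F x.1 x.2).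
Variable Z : set (R * R).
Hypotheses (mZ : measurable (Z : set plane)) (Z0 : mu2 (Z : set plane) = 0%E).
Hypothesis regular : forall q, ~ Z q -> vdensity F 0 q != 0.

Let split_sym (x y z : R) : x + y - 2 * z = (x - z) + (y - z).
Proof. by ring. Qed.

(** Dominated convergence: the symmetric quotients of the densities are bounded by
    twice their Lipschitz constant and tend to 0 outside the null set Z. *)
Lemma symmetric_quotient_area :
  (varied_area C F t + varied_area C F (- t) - 2 * varied_area C F 0) / t
    @[t --> (0 : R)^'] --> (0 : R).
Proof.
have AE t : varied_area C F t = \int[mu2]_(q in (C : set plane)) vdensity F t q.
  exact: sR_areaE.
have mC := measurable_compact2 cC.
have int (f : R * R -> R) : continuous f ->
    mu2.-integrable (C : set plane) (EFin \o f : plane -> \bar R).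
  exact: compact2_integrable.
have [M M0 lip] := vdensity_lipschitz e0 cC C2F.
apply/cvgr_dnbhsP => u [u0 cu].
pose s (n : nat) (q : R * R) :=
  vdensity F (u n) q + vdensity F (- u n) q - 2 * vdensity F 0 q.
(* The cutoff makes D n continuous for every n; it is active for finitely many n
   only. *)
pose D (n : nat) (q : R * R) := if `|u n| < e / 2 then (u n)^-1 * s n q else 0.
have e20 : 0 < e / 2 by rewrite divr_gt0.
have e2e : e / 2 < e by rewrite ltr_pdivrMr // ltr_pMr // ltr1n.
have near_small : \forall n \near \oo, `|u n| < e / 2.
  by move/cvgr0Pnorm_lt : cu; apply.
have z0 : `|0 : R| < e by rewrite normr0.
have cs n : `|u n| < e / 2 -> continuous (s n).
  move=> un q; have ue : `|u n| < e by apply: lt_trans e2e.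
  have Nue : `|- u n| < e by rewrite normrN.
  have c1 : {for q, continuous (vdensity F (u n))}.
    exact: (continuous_vdensity C2F ue).
  have c2 : {for q, continuous (vdensity F (- u n))}.
    exact: (continuous_vdensity C2F Nue).
  have c3 : {for q, continuous (vdensity F 0)} by exact: (continuous_vdensity C2F z0).
  have c4 : {for q, continuous (fun=> 2 : R)} by exact: cst_continuous.
  have c12 : {for q, continuous (fun q => vdensity F (u n) q + vdensity F (- u n) q)}.
    exact: (continuousD c1 c2).
  have c43 : {for q, continuous (fun q => 2 * vdensity F 0 q)}.
    exact: (continuousM c4 c3).
  exact: (continuousB c12 c43).
have cD n : continuous (D n).
  have [un|un] := boolP (`|u n| < e / 2); last first.
    have -> : D n = cst 0 by apply/funext => q; rewrite /D (negbTE un).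
    by move=> q; exact: cst_continuous.
  have -> : D n = fun q => (u n)^-1 * s n q by apply/funext => q; rewrite /D un.
  move=> q; have c4 : {for q, continuous (fun=> (u n)^-1 : R)} by exact: cst_continuous.
  have csq : {for q, continuous (s n)} by exact: (cs n un).
  exact: (continuousM c4 csq).
have bD n q : C q -> `|D n q| <= 2 * M.
  move=> Cq; rewrite /D; case: ifPn => [un|_]; last by rewrite normr0 mulr_ge0.
  have Nun : `|- u n| < e / 2 by rewrite normrN.
  have un0 : 0 < `|u n| by rewrite normr_gt0.
  rewrite normrM normfV mulrC ler_pdivrMr //.
  have -> : s n q = (vdensity F (u n) q - vdensity F 0 q)
                  + (vdensity F (- u n) q - vdensity F 0 q).
    exact: split_sym.
  apply: le_trans (ler_normD _ _) _.
  have h1 := lip q _ Cq un; have h2 := lip q _ Cq Nun; rewrite normrN in h2.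
  by apply: le_trans (lerD h1 h2) _; rewrite -mulrA mulr_natl mulr2n.
have [] := @dominated_convergence _ _ _ mu2 (C : set plane) mC
  (fun n => (EFin \o D n : plane -> \bar R)) (cst 0%E) (cst (2 * M)%:E).
- move=> n; apply/measurable_EFinP; exact: continuous2_measurable.
- exact: measurable_cst.
- exists Z; split => // q /= nq; apply: contrapT => nZ; apply: nq => Cq.
  apply: cvg_EFin; first by apply: nearW.
  have := symmetric_quotient_vdensity e0 C2F (regular nZ).
  move=> /cvgr_dnbhsP /(_ u (conj u0 cu)); apply: cvg_trans.
  apply: near_eq_cvg; apply: filterS near_small => n un.
  by rewrite /= /D un /s mulrC.
- by apply: (int (cst (2 * M))) => q; exact: cst_continuous.
- by apply: aeW => q n Cq; rewrite lee_fin bD.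
move=> _ _; rewrite integral0 => /fine_cvg.
apply: cvg_trans; apply: near_eq_cvg; apply: filterS near_small => n un /=.
have ue : `|u n| < e by apply: lt_trans e2e.
have Nue : `|- u n| < e by rewrite normrN.
have i1 := int _ (continuous_vdensity C2F ue).
have i2 := int _ (continuous_vdensity C2F Nue).
have i3 := int _ (continuous_vdensity C2F z0).
have DI := Rintegral_symmetric (u n)^-1 mC i1 i2 i3.
rewrite (AE (u n)) (AE (- u n)) (AE 0).
apply: etrans (etrans _ DI) (mulrC _ _).
by apply: eq_Rintegral => q _; rewrite /D un.
Qed.

End AreaDerivative.

(** * Stability of vertical planes *)

Section Existence.
Context {R : realType}.

Section Affine.
Variables (W : normedModType R) (A B P0 : W).

Definition affine2 (q : R * R) : W := P0 + (q.1 *: A + q.2 *: B).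

Lemma differentiable_affine2 q : differentiable affine2 q.
Proof.
apply: (@differentiableD _ _ _ (cst P0)); first exact: differentiable_cst.
apply: differentiableD; apply: differentiableZl.
  exact: linear_differentiable (@fst_continuous _ _ _).
exact: linear_differentiable (@snd_continuous _ _ _).
Qed.

Lemma derive_affine2 v q : 'D_v affine2 q = v.1 *: A + v.2 *: B.
Proof.
apply: cvg_lim; first exact: norm_hausdorff.
have E : {near (0 : R)^', (fun=> v.1 *: A + v.2 *: B) =1
    (fun h : R => h^-1 *: ((affine2 \o shift q) (h *: v) - affine2 q))}.
  near=> h; have h0 : h != 0 by near: h; exact: nbhs_dnbhs_neq.
  rewrite /affine2 /= opprD addrACA subrr add0r !scalerDl.
  rewrite [X in _ = _ *: (X - _)]addrACA addrK.
  by rewrite scalerDr !scalerA /GRing.scale /= !mulrA mulVf // !mul1r.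
by apply: cvg_trans (near_eq_cvg E) _; exact: cvg_cst.
Unshelve. all: by end_near. Qed.

Lemma C2_affine2 : Ck_on setT 2 affine2.
Proof.
split; first by move=> q _; exact: differentiable_affine2.
move=> v; have -> : 'D_v affine2 = cst (v.1 *: A + v.2 *: B).
  by apply/funext => q; exact: derive_affine2.
by apply: C1_cst; exact: openT.
Qed.

Lemma immersion_affine2 (q : R * R) :
  (forall s t : R, s *: A + t *: B = 0 -> s = 0 /\ t = 0) ->
  injective ('d affine2 q).
Proof.
move=> free v w vw; apply/eqP; rewrite -subr_eq0; apply/eqP.
have : 'D_(v - w) affine2 q = 0.
  by rewrite deriveE ?linearB ?vw ?subrr //; exact: differentiable_affine2.
rewrite derive_affine2 => /free [].
by case: (v - w) => x y /= -> ->.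
Qed.

End Affine.

(** The coordinates b x - a y and z identify the plane with R * R. *)
Lemma vplane_parametrizable (a b c : R) : a != 0 \/ b != 0 ->
  exists S, parametrizes S (vplane a b c).
Proof.
move=> hab; have N0 : a ^+ 2 + b ^+ 2 != 0 by rewrite gt_eqF // ab_gt0.
set N := a ^+ 2 + b ^+ 2 in N0.
pose A : R * R * R := (b / N, - a / N, 0); pose B : R * R * R := (0, 0, 1).
pose P0 : R * R * R := (- a * c / N, - b * c / N, 0).
have E q : affine2 A B P0 q =
    ((b * q.1 - a * c) / N, (- a * q.1 - b * c) / N, q.2).
  rewrite /affine2 /A /B /P0; congr (_, _, _);
    rewrite /= /GRing.scale /= /GRing.scale /=; first by ring.
    by ring.
  by ring.
pose g (p : R * R * R) : R * R := (b * p.1.1 - a * p.1.2, p.2).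
have gS : cancel (affine2 A B P0) g.
  move=> [u v]; rewrite E /g /=; congr (_, _).
  by rewrite /N; field.
exists (affine2 A B P0); split.
- exact: C2_affine2.
- move=> q; split; first exact: differentiable_affine2.
  apply: immersion_affine2 => s t H.
  have gst : g (affine2 A B P0 (s, t)) = g (affine2 A B P0 0).
    congr (g (P0 + _)); apply: etrans H (esym _).
    by apply: etrans (addr0 _); congr (_ + _); exact: scale0r.
  rewrite !gS in gst; split; [exact: (congr1 fst gst)|exact: (congr1 snd gst)].
- apply/seteqP; split=> [_ [q _ <-]|p pS].
    by rewrite E /vplane /= /N; field.
  exists (g p) => //; rewrite E /g; move: pS; rewrite /vplane /=.
  case: p => [[x y] z] /= pS.
  have hc : c = - (a * x + b * y) by lra.
  by rewrite hc /N; congr (_, _, _); field.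
- exists g; split => //; apply: continuous_subspaceT => p.
  have C1p : Ck_on (setT : set (R * R * R)) 1 (fun p => p).
    apply: (@C1_intro _ _ _ setT _ (fun v x => v)) => //; first exact: openT.
      by move=> v x _; exact: derive_id.
    by move=> v x _; exact: cst_continuous.
  have oT : open (setT : set (R * R * R)) by exact: openT.
  have c1 := C1_continuous (C1B oT (C1M oT (C1_cst b oT) (C1_x oT C1p))
     (C1M oT (C1_cst a oT) (C1_y oT C1p))) (I : setT p).
  have c2 := C1_continuous (C1_z oT C1p) (I : setT p).
  exact: cvg_pair c1 c2.
Qed.

End Existence.

Section Stability.
Context {R : realType}.
Variables (a b c : R) (hab : a != 0 \/ b != 0).
Variables (S : R * R -> R * R * R) (e : R) (C : set (R * R)).
Variable F : R -> R * R -> R * R * R.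
Hypothesis pS : parametrizes S (vplane a b c).
Hypothesis vF : surface_variation S e C F.

Let inS q : vplane a b c (S q).
Proof. by have [_ _ <- _] := pS; exists q. Qed.

Lemma varied_area_ge t : `|t| < e -> varied_area C F 0 <= varied_area C F t.
Proof.
move=> te; have [C2S imm _ _] := pS; have [[e0 cC] C2F F0 _ offC] := vF.
rewrite /varied_area F0.
exact: (vplane_minimizing hab C2S imm inS (C2_varied C2F te) cC
  (fun q => offC t q te)).
Qed.

Lemma varied_area_stationary : is_derive (0 : R) (1 : R) (varied_area C F) 0.
Proof.
have [C2S imm _ _] := pS; have [[e0 cC] C2F F0 _ offC] := vF.
apply: (is_derive_of_symmetric_quotient e0 varied_area_ge).
apply: (symmetric_quotient_area e0 cC C2F
  (Z := [set q | conormalY a b (S q).2 = 0])).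
- apply: measurable_closed2.
  have Cs : Ck_on setT 1 (fun q => conormalY a b (S q).2).
    exact: (C1_conormalY a b (openT : open setT) (C1_z openT (C2_C1 C2S))).
  rewrite (_ : mkset _ = (fun q => conormalY a b (S q).2) @^-1` [set 0]) //.
  by apply: closed_comp => // q _; exact: (C1_continuous Cs I).
- exact: (null_singular_set hab C2S imm inS).
- move=> q /= s0; rewrite /vdensity F0 /hdensity (xflux_vplane hab C2S inS).
  rewrite (yflux_vplane hab C2S inS) expr0n add0r.
  rewrite sqrtr_eq0 -ltNge divr_gt0 // exprn_even_gt0 //= oppr_eq0.
  rewrite mulf_neq0 ?invr_eq0 ?(gt_eqF (ab_gt0 hab)) // mulf_neq0 //.
    exact/eqP.
  exact: param_jac_neq0 hab C2S imm inS q.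
Qed.

Lemma varied_area_stable : second_derivative_ge0 (varied_area C F).
Proof.
have [[e0 _] _ _ _ _] := vF.
exact: (second_derivative_ge0_of_min e0 varied_area_ge varied_area_stationary).
Qed.

End Stability.

Theorem corollary5p6 (R : realType) (a b c : R) (hab : a != 0 \/ b != 0) :
  stable (vplane a b c).
Proof.
split; first split; first exact: vplane_parametrizable.
  by move=> S e C F; exact: varied_area_stationary.
by move=> S e C F; exact: varied_area_stable.
Qed.
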